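(* Let $n\ge 3$ and let $S=\{1,\dots,i,j_1,\dots,j_l\}\subseteq\{1,\dots,n-2\}$ with $i<j_1<\dots<j_l$ and $j_1-i>1$. If $i\le l$, then $b_S(n)>0$.
   Context: $\Pi_n$ is the lattice of set partitions of $\{1,\dots,n\}$ ordered by refinement, with minimum $\hat 0$ (all singletons) and maximum $\hat 1$ (one block); the rank of a partition with $k$ blocks is $n-k$, so the proper part has ranks $1,\dots,n-2$. The symmetric group $S_n$ acts on $\Pi_n$ by permuting $\{1,\dots,n\}$, and hence permutes chains. For $T\subseteq\{1,\dots,n-2\}$ let $\alpha_T$ be the permutation representation of $S_n$ (over $\mathbb{C}$) on the set of chains $\hat 0<x_1<\dots<x_k<\hat 1$ whose set of ranks is exactly $T$. For $S\subseteq\{1,\dots,n-2\}$ put $\beta_S=\sum_{T\subseteq S}(-1)^{|S-T|}\alpha_T$ (equivalently, the $S_n$-representation on the top reduced homology of the order complex of the rank-selected subposet $\Pi_n^S$ of elements with rank in $S$). Let $b_S(n)$ denote the multiplicity of the trivial representation of $S_n$ in $\beta_S$. *)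

(* Defs.v *)
From mathcomp Require Import all_boot all_order all_algebra.
From mathcomp Require Import all_fingroup all_solvable all_field all_character.

Set Implicit Arguments.
Unset Strict Implicit.
Unset Printing Implicit Defensive.

Import GroupScope GRing.Theory Num.Theory.
Local Open Scope ring_scope.

Section PermutationRepresentation.

Variables (F : fieldType) (gT : finGroupType) (rT : finType).
Variables (to : {action gT &-> rT}) (G : {group gT}) (X : {set rT}).

(* Matrices act on row vectors on the right: row i is the image of the i-th
   element of X. *)
Definition permutation_mx (g : gT) : 'M[F]_#|X| :=
  \matrix_(i, j) (enum_val j == to (enum_val i) g)%:R.

Hypothesis actsGX : [acts G, on X | to].

Lemma permutation_mx_repr : mx_repr G permutation_mx.
Proof.
split=> [|g h gG hG]; apply/matrixP=> i j; rewrite !mxE.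
  by rewrite act1 (inj_eq enum_val_inj) eq_sym.
have Xg : to (enum_val i) g \in X by rewrite (acts_act actsGX gG) enum_valP.
rewrite (bigD1 (enum_rank_in Xg (to (enum_val i) g))) //= !mxE.
rewrite enum_rankK_in // eqxx mul1r actM big1 ?addr0 // => k neq_k.
rewrite !mxE; case: eqP => [Ek | _]; last by rewrite mul0r.
by case/eqP: neq_k; apply: enum_val_inj; rewrite enum_rankK_in.
Qed.

Definition permutation_repr : mx_representation F G #|X| :=
  MxRepresentation permutation_mx_repr.

End PermutationRepresentation.

Section PartitionLattice.

Variable n : nat.

(* The ground set is 'I_n = {0, ..., n-1} instead of {1, ..., n}. *)
Definition set_partition (P : {set {set 'I_n}}) : bool := partition P [set: 'I_n].

Definition refines (P Q : {set {set 'I_n}}) : bool :=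
  [forall A in P, exists B in Q, A \subset B].

Definition bottom_partition : {set {set 'I_n}} := [set [set x] | x : 'I_n].
Definition top_partition : {set {set 'I_n}} := [set [set: 'I_n]].

Definition partition_rank (P : {set {set 'I_n}}) : nat := (n - #|P|)%N.

Definition proper_partition (P : {set {set 'I_n}}) : bool :=
  [&& set_partition P, P != bottom_partition & P != top_partition].

Definition proper_chain (C : {set {set {set 'I_n}}}) : bool :=
  [forall P in C, proper_partition P] &&
  [forall P in C, forall Q in C, refines P Q || refines Q P].

(* An element k of 'I_n stands for the rank k itself; proper partitions have
   ranks in {1, ..., n-2}, so no rank is lost. *)
Definition chain_ranks (C : {set {set {set 'I_n}}}) : {set 'I_n} :=
  [set k : 'I_n | [exists P in C, partition_rank P == k]].

Definition chains_of_ranks (T : {set 'I_n}) : {set {set {set {set 'I_n}}}} :=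
  [set C | proper_chain C && (chain_ranks C == T)].

(* The action of 'S_n on points, lifted to blocks, to partitions, and to
   chains. *)
Definition chain_action : {action 'S_n &-> {set {set {set 'I_n}}}} :=
  ('P^*^*^*)%act.

Definition on_partition (P : {set {set 'I_n}}) (s : 'S_n) : {set {set 'I_n}} :=
  ('P^*^*)%act P s.

Lemma act_blockE (A : {set 'I_n}) (s : 'S_n) : ('P^*)%act A s = s @: A.
Proof. by apply: eq_imset. Qed.

Lemma act_partitionE (P : {set {set 'I_n}}) (s : 'S_n) :
  ('P^*^*)%act P s = [set s @: (A : {set 'I_n}) | A in P].
Proof. by apply: eq_imset => A; apply: act_blockE. Qed.

Lemma refines_act P Q s :
  refines P Q -> refines (on_partition P s) (on_partition Q s).
Proof.
move=> /forall_inP refPQ; apply/forall_inP => _ /imsetP[A PA ->].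
have /exists_inP[B QB sAB] := refPQ A PA.
by apply/exists_inP; exists (('P^*)%act B s); [exact: imset_f | exact: imsetS].
Qed.

Lemma partition_rank_act P s :
  partition_rank (on_partition P s) = partition_rank P.
Proof. by rewrite /partition_rank card_setact. Qed.

Lemma set_partition_act P s :
  set_partition P -> set_partition (on_partition P s).
Proof.
rewrite /set_partition /on_partition act_partitionE => partP.
have -> : [set: 'I_n] = s @: [set: 'I_n].
  apply/setP=> x; rewrite inE; apply/esym/imsetP.
  by exists ((s^-1)%g x); rewrite ?inE ?permKV.
by rewrite imset_partition //; apply: perm_inj.
Qed.

Lemma bottom_partition_act s :
  on_partition bottom_partition s = bottom_partition.
Proof.
apply/eqP; rewrite /on_partition eqEcard card_setact leqnn andbT act_partitionE.
apply/subsetP=> _ /imsetP[_ /imsetP[x _ ->] ->].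
by rewrite imset_set1; apply/imsetP; exists (s x).
Qed.

Lemma top_partition_act s : on_partition top_partition s = top_partition.
Proof.
rewrite /on_partition act_partitionE /top_partition imset_set1; congr [set _].
by apply/eqP; rewrite eqEcard subsetT card_imset ?leqnn //; apply: perm_inj.
Qed.

Lemma proper_partition_act P s :
  proper_partition P -> proper_partition (on_partition P s).
Proof.
case/and3P=> partP nbP ntP; apply/and3P; split.
- exact: set_partition_act.
- by rewrite -(bottom_partition_act s) (inj_eq (act_inj _ s)).
- by rewrite -(top_partition_act s) (inj_eq (act_inj _ s)).
Qed.

Lemma chains_of_ranks_act T :
  [acts [set: 'S_n], on chains_of_ranks T | chain_action].
Proof.
apply/subsetP=> s _; rewrite !inE /=.
apply/subsetP=> C; rewrite !inE => /andP[/andP[/forall_inP propC chC] /eqP <-].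
apply/andP; split; first apply/andP; first split.
- by apply/forall_inP=> _ /imsetP[P CP ->]; apply/proper_partition_act/propC.
- apply/forall_inP=> _ /imsetP[P CP ->]; apply/forall_inP=> _ /imsetP[Q CQ ->].
  have /forall_inP/(_ Q CQ)/orP[] := forall_inP chC P CP.
    by move/(refines_act s)=> ->.
  by move/(refines_act s)=> ->; rewrite orbT.
- apply/eqP/setP=> k; rewrite !inE; apply/exists_inP/exists_inP.
    by case=> _ /imsetP[P CP ->]; rewrite partition_rank_act; exists P.
  case=> P CP rkP; exists (on_partition P s); first exact: imset_f.
  by rewrite partition_rank_act.
Qed.

Definition alpha_repr (T : {set 'I_n}) :
    mx_representation algC [set: 'S_n] #|chains_of_ranks T| :=
  permutation_repr algC (chains_of_ranks_act T).

Definition alpha (T : {set 'I_n}) : 'CF([set: 'S_n]) := cfRepr (alpha_repr T).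

(* Virtual representations are identified with their characters. *)
Definition beta (S : {set 'I_n}) : 'CF([set: 'S_n]) :=
  \sum_(T : {set 'I_n} | T \subset S) (-1) ^+ #|S :\: T| *: alpha T.

(* 'chi_0 is the trivial character. *)
Definition trivial_mult (S : {set 'I_n}) : algC := '[beta S, 'chi_0].

End PartitionLattice.

(* Main.v *)
(** Since homology of the rank-selected poset is concentrated in top degree,
    b_S(n) is the dimension of the space of S_n-invariant top cycles: functions
    on the chains of rank set S such that, for every r in S, the sum over all
    ways of inserting an element of rank r vanishes.  Concentration follows
    from semimodularity: a cycle supported above a set X of covers of x is a sum
    of cycles supported above single elements of X.  To see this by induction
    on X and on the ranks, detach the part not lying above X minus u; its
    boundary lives above joins of u with the other covers, which are covers of
    u again, so it can be lifted and corrected.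

    It remains to find one cycle whose average over S_n is not zero.  Take a
    tree on the points and let edge sets grow along S, each edge set
    determining the partition into connected components.  Antisymmetrising over
    permutations of edges, one edge taken from each step, yields a cycle.
    The tree is a spider with i + 1 legs of length two and one long leg:
    the i + 1 outer leg edges are the ranks 1, ..., i (and one more) and are
    permuted among themselves, and the l + 1 edges d_0, ..., d_l that attach
    legs to the centre and extend the long leg one by one are permuted too.
    The number of isolated points shows that any permuted chain in the orbit of
    the original one permutes the inner leg edges and fixes the long leg.
    Since i <= l, the level at which a leg joins the centre identifies it, so the
    outer and inner leg edges undergo the same permutation; its total sign is
    +1 and no cancellation occurs in the orbit of the original chain. *)

Require Import Defs.
From mathcomp Require Import all_boot all_order all_algebra.
From mathcomp Require Import all_fingroup all_solvable all_field all_character.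
From HB Require Import structures.
From mathcomp Require Import zify.

Set Implicit Arguments.
Unset Strict Implicit.
Unset Printing Implicit Defensive.

Import GroupScope GRing.Theory Num.Theory.
Local Open Scope ring_scope.

(** * Cycles of rank-selected semimodular posets *)

(* Reflexivity is only assumed on the field of [le]: elements outside it are
   junk, which lets [P] be larger than the poset. *)
Record semimodular (P : finType) (le : rel P) (rk : P -> nat) (bot top : P) :
    Prop := Semimodular {
  sm_refl : forall x y, le x y -> le x x && le y y;
  sm_trans : transitive le;
  sm_rk_lt : forall x y, le x y -> x != y -> (rk x < rk y)%N;
  sm_bot_refl : le bot bot;
  sm_bot : forall x, le x x -> le bot x;
  sm_top : forall x, le x x -> le x top;
  sm_rk_bot : rk bot = 0;
  sm_cover : forall x z, le x z -> x != z ->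
    exists u, [/\ le x u, le u z & rk u = (rk x).+1];
  sm_join : forall x u v,
    le x u -> le x v -> rk u = (rk x).+1 -> rk v = (rk x).+1 -> u != v ->
    exists w, [/\ rk w = (rk x).+2, le u w, le v w &
                  forall z, le u z -> le v z -> le w z]
}.

Section Poset.

Variables (P : finType) (le : rel P) (rk : P -> nat) (bot top : P).

Definition is_chain (C : {set P}) :=
  [forall x in C, forall y in C, le x y || le y x].

Definition has_rank (C : {set P}) (r : nat) := [exists x in C, rk x == r].

Variable K : zmodType.
Implicit Types (f g : {ffun {set P} -> K}) (C D X : {set P}) (A R : pred nat) (U : pred P).

(** The part of the simplicial boundary that deletes the element of rank [r]. Faces with different
    missing ranks never meet, so each rank is treated separately and no signs occur. *)
Definition bd (r : nat) f C : K := \sum_(y | rk y == r) f (y |: C).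

Definition supported A U f :=
  forall C, f C != 0 ->
    [/\ is_chain C, has_rank C =1 A & {in C, forall x, U x}].

Definition killed R f := forall r C, R r -> ~~ has_rank C r -> bd r f C = 0.

(** [A] is the rank set of the chains and [R] the set of ranks at which the boundary vanishes. For
    [A = R] these are the top cycles; a smaller [R] gives the intermediate spaces of the dimension
    count. *)
Definition cycle_in A R U f := supported A U f /\ killed R f.

Lemma chainP C x y : is_chain C -> x \in C -> y \in C -> le x y \/ le y x.
Proof. by move=> /forall_inP/(_ x)H /H/forall_inP/(_ y){}H /H /orP. Qed.

Lemma has_rankP C r :
  reflect (exists2 x, x \in C & rk x = r) (has_rank C r).
Proof.
apply: (iffP exists_inP) => -[x xC]; first by move/eqP; exists x.
by move=> <-; exists x.
Qed.

Lemma has_rankU1 C y r : has_rank (y |: C) r = (rk y == r) || has_rank C r.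
Proof.
apply/has_rankP/orP=> [[x /setU1P[->|xC] <-]|[/eqP <-|/has_rankP[x xC <-]]].
- by left.
- by right; apply/has_rankP; exists x.
- by exists y => //; exact: setU11.
- by exists x => //; exact: setU1r.
Qed.

Lemma has_rank_mem C x : x \in C -> has_rank C (rk x).
Proof. by move=> xC; apply/has_rankP; exists x. Qed.

Lemma bdD r f g C : bd r (f + g) C = bd r f C + bd r g C.
Proof. by rewrite /bd -big_split; apply: eq_bigr => y _; rewrite ffunE. Qed.

Lemma bdN r f C : bd r (- f) C = - bd r f C.
Proof. by rewrite /bd -sumrN; apply: eq_bigr => y _; rewrite ffunE. Qed.

Lemma bd0 r C : bd r 0 C = 0.
Proof. by rewrite /bd big1 // => y _; rewrite ffunE. Qed.

Lemma cycle_in0 A R U : cycle_in A R U 0.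
Proof. by split=> [C|r C _ _]; rewrite ?ffunE ?eqxx // bd0. Qed.

Lemma cycle_inD A R U f g :
  cycle_in A R U f -> cycle_in A R U g -> cycle_in A R U (f + g).
Proof.
move=> [sf kf] [sg kg]; split=> [C|r C Rr Cr].
  rewrite ffunE; have [->|/sf//] := eqVneq (f C) 0; rewrite add0r; exact: sg.
by rewrite bdD kf // kg // addr0.
Qed.

Lemma cycle_in_eq A A' R R' (U U' : pred P) f :
    A =1 A' -> (forall r, R' r -> R r) -> (forall x, U x -> U' x) ->
  cycle_in A R U f -> cycle_in A' R' U' f.
Proof.
move=> eA sR sU [sf kf]; split=> [C /sf[cC rC uC]|r C /sR Rr]; last exact: kf.
by split=> // [r|x /uC /sU //]; rewrite rC eA.
Qed.

Hypothesis smP : semimodular le rk bot top.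

Let le_refl := sm_refl smP.
Let le_trans := sm_trans smP.
Let rk_lt := sm_rk_lt smP.
Let bot_refl := sm_bot_refl smP.
Let le_bot := sm_bot smP.
Let le_top := sm_top smP.
Let rk_bot := sm_rk_bot smP.
Let le_cover := sm_cover smP.
Let le_join := sm_join smP.

Lemma chain_le C x y : is_chain C -> x \in C -> y \in C ->
  (rk x <= rk y)%N -> le x y.
Proof.
move=> cC xC yC rxy; case: (chainP cC xC yC) => // lyx.
have [eyx|nyx] := eqVneq y x; first by rewrite {1}eyx in lyx; rewrite -eyx in lyx *.
by have := rk_lt lyx nyx; lia.
Qed.

(** * Splitting cycles over covers and lifting them by one rank *)

Variable S : pred nat.
Hypothesis S_lt : forall r, S r -> (r < rk top)%N.

Definition from k : pred nat := fun r => S r && (k <= r)%N.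
Definition above X : pred P := fun z => [exists u in X, le u z].

Lemma aboveP X z : reflect (exists2 u, u \in X & le u z) (above X z).
Proof. exact: exists_inP. Qed.

(* Every cycle above [X] is a sum of cycles above single elements of [X]; the
   sum is hidden in the closure of [Q] under addition. *)
Definition cover_split k := forall x X,
  ((rk x).+2 <= k)%N -> X != set0 ->
  {in X, forall u, le x u /\ rk u = (rk x).+1} ->
  forall Q : {ffun {set P} -> K} -> Prop,
  (forall f g, Q f -> Q g -> Q (f + g)) ->
  (forall u f, u \in X -> cycle_in (from k) (from k) (le u) f -> Q f) ->
  forall f, cycle_in (from k) (from k) (above X) f -> Q f.

(** Acyclicity of the part of the poset above [v], phrased as surjectivity of the boundary at rank
    [k]. *)
Definition lifts k := forall v, (rk v <= k)%N -> le v v -> (k < rk top)%N ->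
  forall c, cycle_in (from k.+1) (from k.+1) (le v) c ->
  exists2 g, cycle_in (fun r => (r == k) || from k.+1 r) (from k.+1) (le v) g &
    forall C, ~~ has_rank C k -> bd k g C = c C.

Lemma fromS k : S k -> from k =1 (fun r => (r == k) || from k.+1 r).
Proof.
move=> Sk r; rewrite /from leq_eqVlt [k == r]eq_sym.
by case: eqP => [->|_]; rewrite ?Sk.
Qed.

Lemma fromSn k : ~~ S k -> from k =1 from k.+1.
Proof.
move=> Sk r; rewrite /from leq_eqVlt.
by case: eqP => //= <-; rewrite (negPf Sk).
Qed.

(** Induction on [k - rk v]. If [v] has rank [k], the cone with apex [v] is a lift. Otherwise every
    chain lies above the covers of [v], and splitting over them reduces to an element one rank
    closer to [k]. *)
Lemma cover_split_lifts k : cover_split k.+1 -> lifts k.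
Proof.
move=> Ksp v; have [m] := ubnP (k - rk v); elim: m v => // m IHm v lem rvk vv kt c cc.
have [rv|nrv] := eqVneq (rk v) k.
  pose g := [ffun C : {set P} => if v \in C then c (C :\ v) else 0].
  have [sc kc] := cc.
  exists g; first split=> [C|r C /andP[Sr kr] Cr].
  - rewrite ffunE; case: ifP => [vC /sc[cC rC uC]|]; last by rewrite eqxx.
    rewrite -(setD1K vC); split=> [|r|x].
    + apply/forall_inP=> x /setU1P[->|xC]; apply/forall_inP=> y /setU1P[->|yC].
      * by rewrite vv.
      * by rewrite uC.
      * by rewrite uC ?orbT.
      * by apply/orP; apply: (chainP cC).
    + by rewrite has_rankU1 rv rC eq_sym.
    + by case/setU1P=> [-> //|/uC].
  - have nvy y : rk y == r -> v != y by apply: contraL => /eqP <-; rewrite rv; lia.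
    rewrite /bd (eq_bigr (fun y => if v \in C then c (y |: (C :\ v)) else 0)).
      have [vC|_] := boolP (v \in C); last by rewrite big1.
      apply: kc; first by rewrite /from Sr.
      by apply: contra Cr => /has_rankP[x /setD1P[_ xC] <-]; apply: has_rank_mem.
    move=> y /nvy nvy'; rewrite ffunE in_setU1 (negPf nvy') /=; case: ifP => // _.
    by congr (c _); rewrite setDUl; congr (_ :|: _); apply/setDidPl; rewrite disjoints1 inE eq_sym.
  - move=> C Ck; have vC : v \notin C by apply: contra Ck => /has_rank_mem; rewrite rv.
    rewrite /bd (bigD1 v) ?rv //= ffunE setU11 setU1K // big1 ?addr0 // => y /andP[_ nyv].
    by rewrite ffunE in_setU1 eq_sym (negPf nyv) (negPf vC).
have ltvk : (rk v < k)%N by rewrite ltn_neqAle nrv.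
pose X := [set u | le v u & rk u == (rk v).+1].
have XP u : u \in X -> le v u /\ rk u = (rk v).+1 by rewrite inE => /andP[? /eqP].
pose Q c := exists2 g,
  cycle_in (fun r => (r == k) || from k.+1 r) (from k.+1) (le v) g &
  forall C, ~~ has_rank C k -> bd k g C = c C.
apply: (Ksp v X _ _ XP Q _ _ c); first by lia.
- have nvt : v != top by apply: contraTneq kt => <-; rewrite -leqNgt; lia.
  have [u [vu _ ru]] := le_cover (le_top vv) nvt.
  by apply/set0Pn; exists u; rewrite inE vu ru eqxx.
- move=> f1 f2 [g1 [sg1 kg1] bg1] [g2 [sg2 kg2] bg2]; exists (g1 + g2).
    by apply: cycle_inD; split.
  by move=> C Ck; rewrite bdD bg1 // bg2 // ffunE.
- move=> u f /XP[vu ru] cf; have := IHm u _ _ _ kt f cf.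
  case; first by lia.
  + by lia.
  + by case/andP: (le_refl vu).
  + move=> g cg bg; exists g => //; apply: cycle_in_eq cg => // x; exact: le_trans.
have [sc kc] := cc; split=> // C /sc[cC rC uC]; split=> // x xC.
have vx := uC x xC; have nvx : v != x.
  apply: contraTneq (has_rank_mem xC) => <-; rewrite rC /from negb_and; lia.
have [u [vu ux ru]] := le_cover vx nvx.
by apply/aboveP; exists u => //; rewrite inE vu ru /=.
Qed.

Lemma cover_split_step k : cover_split k.+1 -> cover_split k.
Proof.
move=> Ksp; have Kl := cover_split_lifts Ksp.
move=> x X rxk X0 XP Q QD Qu f cf.
have [Sk|Sk] := boolP (S k); last first.
  apply: (Ksp x X _ X0 XP Q QD) => //; first by lia.
    move=> u g uX cg; apply: (Qu u) => //; apply: cycle_in_eq cg => // r.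
      by rewrite (fromSn Sk).
    by rewrite (fromSn Sk).
  by apply: cycle_in_eq cf => // r; rewrite (fromSn Sk).
have kt := S_lt Sk; have rkS r : from k.+1 r -> from k r /\ r != k.
  by rewrite /from => /andP[-> ?]; rewrite ltnW //; split=> //; apply/eqP; lia.
have fkk : from k k by rewrite /from Sk leqnn.
have least C w z : is_chain C -> has_rank C =1 from k -> w \in C -> rk w = k ->
    z \in C -> le w z.
  move=> cC rC wC rw zC; apply: (chain_le cC wC zC).
  by have := has_rank_mem zC; rewrite rC => /andP[_]; rewrite rw.
have [m] := ubnP #|X|; elim: m => // m IHm in X X0 XP Qu f cf * => lem.
have /set0Pn[u uX] := X0; pose X' := X :\ u.
have [X'0|X'0] := eqVneq X' set0.
  apply: (Qu u) => //; apply: cycle_in_eq cf => // z /exists_inP[v vX vz].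
  suff -> : u = v by [].
  by apply/esym/eqP; have := in_set0 v; rewrite -X'0 !inE vX andbT => /negbFE.
(* The test [b] reads only the element of rank [k], so the two pieces [f1] and [f2] inherit the zero
   boundaries at all higher ranks. *)
pose b C := [exists w in C, (rk w == k) && above X' w].
have bU y C : rk y != k -> b (y |: C) = b C.
  move=> ry; apply/exists_inP/exists_inP=> -[w wC aw]; exists w => //.
    by case/setU1P: wC aw => // ->; rewrite (negPf ry).
  exact: setU1r.
pose f1 := [ffun C => if b C then f C else 0].
pose f2 := [ffun C => if b C then 0 else f C].
have f12 : f = f1 + f2 by apply/ffunP=> C; rewrite !ffunE; case: ifP; rewrite ?addr0 ?add0r.
have [sf kf] := cf.
have s1 : supported (from k) (above X') f1.
  move=> C; rewrite ffunE; case: ifP => [/exists_inP[w wC /andP[/eqP rw aw]]|];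
    last by rewrite eqxx.
  move=> /sf[cC rC uC]; split=> // z zC; case/aboveP: aw => v vX vw.
  by apply/aboveP; exists v => //; apply: le_trans vw _; apply: (least _ _ _ cC rC).
have s2 : supported (from k) (le u) f2.
  move=> C; rewrite ffunE; case: ifPn => [_|nb]; first by rewrite eqxx.
  move=> /sf[cC rC uC]; split=> // z zC.
  have /has_rankP[w wC rw] : has_rank C k by rewrite rC.
  apply: (@le_trans w); last exact: (least _ _ _ cC rC).
  case/aboveP: (uC w wC) => v vX vw; have [<- //|nvu] := eqVneq v u.
  case/negP: nb; rewrite /b; apply/exists_inP; exists w => //; rewrite rw eqxx.
  by apply/aboveP; exists v => //; rewrite !inE nvu.
have k1 r C : from k.+1 r -> ~~ has_rank C r -> bd r f1 C = 0.
  move=> /rkS[fr nr] Cr.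
  rewrite /bd (eq_bigr (fun y => if b C then f (y |: C) else 0)).
    case: (b C); last by rewrite big1.
    by apply: kf => //; case/rkS: fr.
  by move=> y /eqP ry; rewrite ffunE bU // ry.
have k2 r C : from k.+1 r -> ~~ has_rank C r -> bd r f2 C = 0.
  move=> fr Cr; have : bd r f C = 0 by apply: kf => //; case/rkS: fr.
  by rewrite f12 bdD k1 // add0r.
(* Covers of [u] that also lie above [X']. By semimodularity the joins of [u] with members of [X']
   are among them, so everything above both [u] and [X'] is above [Y]. *)
pose Y := [set v | [&& le u v, rk v == (rk u).+1 & above X' v]].
have [xu ru] := XP u uX; have /andP[_ uu] := le_refl xu.
have joinY z u' : u' \in X' -> le u z -> le u' z ->
    exists2 v, v \in Y & le v z.
  move=> /setD1P[nu' u'X] uz u'z; have [xu' ru'] := XP u' u'X.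
  have nuu' : u != u' by rewrite eq_sym.
  have [v [rv uv u'v vz]] := le_join xu xu' ru ru' nuu'.
  exists v; last exact: vz.
  rewrite inE uv rv ru eqxx; apply/aboveP; exists u' => //.
  by rewrite !inE nu' u'X.
have Y0 : Y != set0.
  case/set0Pn: X'0 => u' u'X; have /setD1P[_ u'X'] := u'X.
  have /andP[_ u'u'] := le_refl (proj1 (XP u' u'X')).
  have [v vY _] := joinY top u' u'X (le_top uu) (le_top u'u').
  by apply/set0Pn; exists v.
(* Since [f] has zero boundary at rank [k], the boundaries of [f1] and [f2] there differ only by
   sign. Hence [c] lives above [u] and above [X'], that is, above [Y]. *)
pose c := [ffun D => if has_rank D k then 0 else bd k f2 D].
have cc : cycle_in (from k.+1) (from k.+1) (above Y) c.
  split=> [D|r D fr Dr].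
    rewrite ffunE; case: ifPn => [_|Dk b0]; first by rewrite eqxx.
    have [y2 ry2 f2y] : exists2 y, rk y == k & f2 (y |: D) != 0.
      apply/exists_inP; apply: contra_neqT b0; rewrite negb_exists_in.
      by move/forall_inP=> H; apply: big1 => y /H; rewrite negbK => /eqP.
    have : bd k f D = 0 by apply: kf.
    rewrite f12 bdD => /eqP; rewrite addr_eq0 => /eqP b12.
    have b1 : bd k f1 D != 0 by rewrite b12 oppr_eq0.
    have [y1 ry1 f1y] : exists2 y, rk y == k & f1 (y |: D) != 0.
      apply/exists_inP; apply: contra_neqT b1; rewrite negb_exists_in.
      by move/forall_inP=> H; apply: big1 => y /H; rewrite negbK => /eqP.
    have [cD rD uD] := s2 _ f2y; have [_ _ aD] := s1 _ f1y; split.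
    - apply/forall_inP=> z zD; apply/forall_inP=> w wD; apply/orP.
      by apply: (chainP cD); apply: setU1r.
    - move=> r; have := rD r; rewrite has_rankU1 (eqP ry2) fromS // [r == k]eq_sym.
      by case: eqP => //= <- _; rewrite (negPf Dk) /from ltnn andbF.
    - move=> z zD; have uz := uD z (setU1r _ zD).
      have /aboveP[u' u'X u'z] := aD z (setU1r _ zD).
      have [v vY vz] := joinY z u' u'X uz u'z.
      by apply/aboveP; exists v.
  have [_ nrk] := rkS r fr.
  rewrite /bd (eq_bigr (fun y => if has_rank D k then 0 else bd k f2 (y |: D))).
    have [_|Dk] := boolP (has_rank D k); first by rewrite big1.
    rewrite /bd exchange_big /= big1 // => y /eqP ry.
    rewrite (eq_bigr (fun z => f2 (z |: (y |: D)))) => [|z _]; last by rewrite setUCA.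
    by apply: k2; rewrite // has_rankU1 ry eq_sym (negPf nrk).
  by move=> y /eqP ry; rewrite ffunE has_rankU1 ry (negPf nrk).
have [g [sg kg] bg] : exists2 g, cycle_in (from k) (from k.+1) (above Y) g &
    forall C, ~~ has_rank C k -> bd k g C = c C.
  pose Qc (c : {ffun {set P} -> K}) :=
    exists2 g, cycle_in (from k) (from k.+1) (above Y) g &
      forall C, ~~ has_rank C k -> bd k g C = c C.
  apply: (Ksp u Y _ Y0 _ Qc _ _ c cc); first by lia.
  - by move=> v; rewrite inE => /and3P[uv /eqP rv _].
  - move=> g1 g2 [h1 ch1 bh1] [h2 ch2 bh2]; exists (h1 + h2); first exact: cycle_inD.
    by move=> C Ck; rewrite bdD bh1 // bh2 // ffunE.
  - move=> v g vY cg; have : v \in Y by [].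
    rewrite inE => /and3P[uv /eqP rv _].
    have [||h ch bh] := Kl v _ _ kt g cg.
    + by lia.
    + by case/andP: (le_refl uv).
    exists h => //; apply: cycle_in_eq ch => // [r|z vz]; first by rewrite (fromS Sk).
    by apply/aboveP; exists v.
have cg r C : from k r -> ~~ has_rank C r ->
    bd r g C = if r == k then bd k f2 C else 0.
  move=> fr; case: eqP => [-> Ck|nrk Cr]; first by rewrite bg // ffunE (negPf Ck).
  by apply: kg => //; move: fr; rewrite (fromS Sk); case/orP=> // /eqP.
(* The lift [g] of [c] corrects both pieces: [f2 - g] is a cycle above [u], and [f1 + g] is a cycle
   above the smaller set [X']. *)
have -> : f = (f2 - g) + (f1 + g) by rewrite [LHS]f12 addrC addrACA addNr addr0 addrC.
apply: QD.
  apply: (Qu u) => //; split=> [C|r C fr Cr].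
    rewrite ffunE [(- g) C]ffunE; have [->|nf _] := eqVneq (f2 C) 0; last exact: s2.
    rewrite sub0r oppr_eq0 => /sg[cC rC yC]; split=> // z zC.
    case/aboveP: (yC z zC) => v; rewrite inE => /andP[uv _].
    exact: le_trans.
  rewrite bdD bdN cg //; case: eqP => [->|nrk]; first by rewrite subrr.
  by rewrite subr0; apply: k2 => //; move: fr; rewrite (fromS Sk); case/orP=> // /eqP.
apply: (IHm X') => //.
- by move=> v /setD1P[_ /XP].
- by move=> v h /setD1P[_ vX]; apply: Qu.
- split=> [C|r C fr Cr].
    rewrite ffunE; have [->|nf _] := eqVneq (f1 C) 0; last exact: s1.
    rewrite add0r => /sg[cC rC yC]; split=> // z zC.
    case/aboveP: (yC z zC) => v; rewrite inE => /and3P[_ _ /aboveP[w wX wv]] vz.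
    by apply/aboveP; exists w => //; apply: le_trans vz.
  rewrite bdD cg //; case: eqP => [erk|nrk].
    by rewrite -erk -bdD -f12; apply: kf.
  by rewrite addr0; apply: k1 => //; move: fr; rewrite (fromS Sk); case/orP=> // /eqP.
- by move: lem; rewrite (cardsD1 u X) uX.
Qed.

(** Descending induction on [k]. From the rank of [top] on no ranks of [S] remain, so only the empty
    chain can carry a value and any [u] in [X] serves. *)
Lemma cover_splitT k : cover_split k.
Proof.
have [m] := ubnP (rk top - k); elim: m k => // m IHm k lem.
have [kt|tk] := ltnP k (rk top).
  by apply: cover_split_step; apply: IHm; move: lem kt; lia.
move=> x X _ /set0Pn[u uX] _ Q _ Qu f [sf _]; apply: (Qu u _ uX).
have from0 r : from k r = false.
  by apply: contraTF tk => /andP[/S_lt rt kr]; rewrite -ltnNge (leq_ltn_trans kr).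
split=> [C /sf[cC rC _]|r C]; last by rewrite from0.
split=> // x' /has_rank_mem; by rewrite rC from0.
Qed.

(** * Inserting a rank above fixed lower parts of chains *)

Definition below k C := [set x in C | (rk x < k)%N].

Lemma below_sub k C x : x \in below k C -> x \in C.
Proof. by rewrite inE => /andP[]. Qed.

Lemma belowU1 k y C : (k <= rk y)%N -> below k (y |: C) = below k C.
Proof.
move=> ky; apply/setP=> x; rewrite !inE.
by have [->|//] := eqVneq x y; rewrite [(rk y < k)%N]ltnNge ky !andbF.
Qed.

(** Boundaries at ranks above [k] leave the lower part of a chain alone, so the function splits
    according to that part [c]. What remains of the chains lies above a single element of rank less
    than [k], where [lifts] applies. *)
Lemma below_lift k A f : (0 < k < rk top)%N -> (forall r, A r -> (r < k)%N) ->
  cycle_in (fun r => A r || from k.+1 r) (from k.+1) (fun x => le x x) f ->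
  exists2 g,
    cycle_in (fun r => [|| r == k, A r | from k.+1 r]) (from k.+1)
             (fun x => le x x) g &
    forall C, ~~ has_rank C k -> bd k g C = f C.
Proof.
move=> /andP[k0 kt] Ak cf.
pose Q (h : {ffun {set P} -> K}) := exists2 g,
    cycle_in (fun r => [|| r == k, A r | from k.+1 r]) (from k.+1)
             (fun x => le x x) g &
    forall C, ~~ has_rank C k -> bd k g C = h C.
pose part c := [ffun C => if below k C == c then f C else 0].
have -> : f = \sum_c part c.
  apply/ffunP=> C; rewrite sum_ffunE (bigD1 (below k C)) //= ffunE eqxx.
  by rewrite big1 ?addr0 // => c nc; rewrite ffunE eq_sym (negPf nc).
change (Q (\sum_c part c)); apply: (big_ind Q).
- by exists 0; [exact: cycle_in0 | move=> C _; rewrite bd0 ffunE].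
- move=> f1 f2 [g1 cg1 bg1] [g2 cg2 bg2]; exists (g1 + g2).
    exact: cycle_inD.
  by move=> C Ck; rewrite bdD bg1 // bg2 // ffunE.
move=> c _; set fc := part c; have [sf kf] := cf.
have [C0 fC0|fc0] := pickP (fun C => fc C != 0); last first.
  exists 0; first exact: cycle_in0.
  by move=> C _; rewrite bd0; apply/esym/eqP/negPn; rewrite fc0.
have [cC0 rC0 uC0 eC0] : [/\ is_chain C0, has_rank C0 =1 (fun r => A r || from k.+1 r),
    {in C0, forall x, le x x} & below k C0 = c].
  move: fC0; rewrite ffunE; case: ifP => [/eqP e /sf[? ? ?]|_]; first by split.
  by rewrite eqxx.
have subc x : x \in c -> x \in C0 /\ (rk x < k)%N by rewrite -eC0 inE => /andP.
have rankc r : has_rank c r = A r.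
  apply/has_rankP/idP=> [[x /subc[xC xk] <-]|Ar].
    have := has_rank_mem xC; rewrite rC0 => /orP[//|/andP[_]]; lia.
  have /has_rankP[x xC rx] : has_rank C0 r by rewrite rC0 Ar.
  by exists x => //; rewrite -eC0 inE xC rx Ak.
(* [v] is the maximum of [c], or [bot] when [c] is empty; [0 < k] keeps the rank of [bot] below
   [k]. *)
have [v [vv rv cv vD]] : exists v, [/\ le v v, (rk v < k)%N, {in c, forall x, le x v} &
    forall D, below k D == set0 -> f (c :|: D) != 0 -> {in D, forall z, le v z}].
  have [c0|[x0 x0c]] := set_0Vmem c.
    exists bot; split=> //; first by rewrite rk_bot.
      by move=> x; rewrite c0 inE.
    move=> D _ /sf[_ _ uD] z zD; apply/le_bot/uD.
    by rewrite inE zD orbT.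
  case: (arg_maxnP rk x0c) => v vc' vmax.
  have vc : v \in c by []; have [vC vk] := subc v vc.
  exists v; split=> //; first exact: uC0.
    by move=> x xc; apply: (chain_le cC0 (proj1 (subc x xc)) vC); apply: vmax.
  move=> D /eqP D0 /sf[cD _ _] z zD; apply: (chain_le cD).
  - by rewrite inE vc.
  - by rewrite inE zD orbT.
  - have: z \notin below k D by rewrite D0 inE.
    by rewrite inE zD -leqNgt; apply: leq_trans; apply: ltnW.
have kfc r C : from k.+1 r -> ~~ has_rank C r -> bd r fc C = 0.
  move=> fr Cr; rewrite /bd (eq_bigr (fun y => if below k C == c then f (y |: C) else 0)).
    by case: eqP => _; [apply: kf | rewrite big1].
  by move=> y /eqP ry; rewrite ffunE belowU1 // ry; case/andP: fr => _ /ltnW.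
(* [h] is [fc] with the lower part [c] stripped off. The guard on [below] keeps a chain from being
   counted again with points of [c] added to it. *)
pose h := [ffun D => if below k D == set0 then fc (c :|: D) else 0].
have ch : cycle_in (from k.+1) (from k.+1) (le v) h.
  split=> [D|r D fr Dr].
    rewrite ffunE; case: ifP => [D0|]; last by rewrite eqxx.
    rewrite ffunE; case: ifP => [_ fD|]; last by rewrite eqxx.
    have [cD rD uD] := sf _ fD; split; last exact: vD.
      apply/forall_inP=> x xD; apply/forall_inP=> y yD; apply/orP.
      by apply: (chainP cD); rewrite inE ?xD ?yD orbT.
    have Dk x : x \in D -> (k <= rk x)%N.
      move=> xD; have: x \notin below k D by rewrite (eqP D0) inE.
      by rewrite inE xD -leqNgt.
    move=> r; apply/has_rankP/idP=> [[x xD <-]|fr].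
      have := @has_rank_mem (c :|: D) x; rewrite inE xD orbT rD => /(_ isT).
      by case/orP=> // /Ak; rewrite ltnNge Dk.
    have /has_rankP[x] : has_rank (c :|: D) r by rewrite rD fr orbT.
    case/setUP=> [/subc[_ xk] rx|xD rx]; last by exists x.
    by case/andP: fr; lia.
  rewrite /bd (eq_bigr (fun y => if below k D == set0 then fc (y |: (c :|: D)) else 0)).
    case: eqP => _; last by rewrite big1.
    apply: kfc => //; apply/has_rankP=> -[x /setUP[/subc[_ xk]|xD] rx].
      by case/andP: fr; lia.
    by case/has_rankP: Dr; exists x.
  move=> y /eqP ry; rewrite ffunE belowU1; last by rewrite ry; case/andP: fr => _ /ltnW.
  by rewrite setUCA.
have [g [sg kg] bg] := cover_split_lifts (@cover_splitT k.+1) (ltnW rv) vv kt ch.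
have nc y : (k <= rk y)%N -> y \notin c.
  by move=> ky; apply/negP=> /subc[_]; rewrite ltnNge ky.
have setDc y C : (k <= rk y)%N -> (y |: C) :\: c = y |: (C :\: c).
  move=> /nc yc; rewrite setDUl; congr (_ :|: _).
  by apply/setDidPl; rewrite disjoints1.
pose w := [ffun C => if below k C == c then g (C :\: c) else 0].
exists w; first split=> [C|r C fr Cr].
- rewrite ffunE; case: ifP => [/eqP eC|]; last by rewrite eqxx.
  move=> /sg[cC rC uC]; have CE : C = c :|: C :\: c.
    apply/setP=> x; rewrite !inE; case: (boolP (x \in c)) => //=.
    by rewrite -eC => /below_sub.
  split.
  + apply/forall_inP=> x; rewrite CE => /setUP[xc|xC]; apply/forall_inP=> y /setUP[yc|yC].
    * by apply/orP/(chainP cC0); [case: (subc x xc) | case: (subc y yc)].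
    * by rewrite (le_trans (cv x xc) (uC y yC)).
    * by rewrite (le_trans (cv y yc) (uC x xC)) orbT.
    * by apply/orP/(chainP cC).
  + move=> r; rewrite orbCA -rC -rankc; apply/has_rankP/orP=> [[x]|].
      rewrite {1}CE => /setUP[xc|xC] <-; [left|right]; exact: has_rank_mem.
    by case=> /has_rankP[x xC rx]; exists x => //; rewrite CE inE xC ?orbT.
  + move=> x; rewrite CE => /setUP[/subc[xC _]|/uC vx]; first exact: uC0.
    by case/andP: (le_refl vx).
- have kr : (k <= r)%N by case/andP: fr => _ /ltnW.
  rewrite /bd (eq_bigr (fun y => if below k C == c then g (y |: (C :\: c)) else 0)).
    case: eqP => _; last by rewrite big1.
    apply: kg => //; apply: contra Cr => /has_rankP[x /setDP[xC _] <-].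
    exact: has_rank_mem.
  by move=> y /eqP ry; rewrite ffunE belowU1 ?setDc ?ry.
- move=> C Ck; rewrite /bd (eq_bigr (fun y => if below k C == c then g (y |: (C :\: c)) else 0)).
    case: eqP => [eC|/eqP/negPf nC]; last by rewrite big1 // ffunE nC.
    rewrite -/(bd k g _) bg; last first.
      apply: contra Ck => /has_rankP[x /setDP[xC _] <-]; exact: has_rank_mem.
    rewrite ffunE; case: eqP => [_|[]].
      congr (fc _); apply/setP=> x; rewrite !inE; case: (boolP (x \in c)) => //=.
      by rewrite -eC => /below_sub.
    apply/setP=> x; rewrite !inE; apply/negP=> /andP[/andP[xc xC] xk].
    by case/negP: xc; rewrite -eC inE xC.
  by move=> y /eqP ry; rewrite ffunE belowU1 ?setDc ?ry.
Qed.

End Poset.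

(** * Invariant cycles *)

Lemma sum_subsets_setU1 (R : nmodType) (I : finType) (x : I) (B : {set I})
    (E : {set I} -> R) : x \notin B ->
  \sum_(T : {set I} | T \subset x |: B) E T =
  \sum_(T : {set I} | T \subset B) E T +
  \sum_(T : {set I} | T \subset B) E (x |: T).
Proof.
move=> xB; rewrite (bigID (fun T : {set I} => x \in T)) /= addrC; congr (_ + _).
  apply: eq_bigl => T; apply/andP/idP=> [[TB xT]|TB].
    by rewrite -(setU1K xB) subsetD1 TB.
  split; first exact: subset_trans TB (subsetUr _ _).
  by apply: contra xB => /(subsetP TB).
rewrite (reindex_onto (fun T => x |: T) (fun T => T :\ x)) /=; last first.
  by move=> T /andP[_ xT]; rewrite setD1K.
apply: eq_bigl => T; rewrite setU11 andbT; apply/andP/idP=> [[TB /eqP eT]|TB].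
  have xT : x \notin T by rewrite -eT !inE eqxx.
  by rewrite -(setU1K xB) -(setU1K xT) setSD.
split; first exact: setUS.
by rewrite setU1K //; apply: contra xB => /(subsetP TB).
Qed.

Section InvariantCycles.

Variables (P : finType) (le : rel P) (rk : P -> nat) (bot top : P).
Variables (gT : finGroupType) (G : {group gT}) (to : {action gT &-> P}).
Variables (F : numFieldType) (N : nat).

Hypothesis smP : semimodular le rk bot top.
Hypothesis le_act : forall x y a, a \in G -> le (to x a) (to y a) = le x y.
Hypothesis rk_act : forall x a, a \in G -> rk (to x a) = rk x.

Notation W := {ffun {set P} -> F^o}.
Notation dom := (fun x => le x x).
Notation cact := (to^*)%act.
Implicit Types (f g : W) (C D : {set P}) (A R : pred nat) (T L S : {set 'I_N}).

Definition inv_fun f := forall C a, a \in G -> f (cact C a) = f C.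

(** Boolean form of the support condition; it tests the presence of ranks below [N] only, a bound
    that [goodP] assumes for [A]. *)
Definition good A C := [&& is_chain le C, [forall x in C, A (rk x)] &
  [forall r : 'I_N, A r ==> has_rank rk C r]].

Lemma goodP A C : (forall r, A r -> (r < N)%N) ->
  reflect (is_chain le C /\ has_rank rk C =1 A) (good A C).
Proof.
move=> AN; apply: (iffP and3P) => [[cC /forall_inP rC /forallP hC]|[cC rC]].
  split=> // r; apply/has_rankP/idP=> [[x /rC Ax <-] //|Ar].
  by apply/has_rankP; have /implyP/(_ Ar) := hC (Ordinal (AN r Ar)).
split=> //; first by apply/forall_inP=> x /has_rank_mem-/(_ rk); rewrite rC.
by apply/forallP=> r; rewrite rC implybb.
Qed.

Lemma cactE C a : cact C a = [set to x a | x in C].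
Proof. by []. Qed.

Lemma cactU1 y C a : cact (y |: C) a = to y a |: cact C a.
Proof. by rewrite !cactE imsetU1. Qed.

Lemma is_chain_act C a : a \in G -> is_chain le (cact C a) = is_chain le C.
Proof.
move=> aG; apply/forall_inP/forall_inP=> cC x.
  move=> xC; apply/forall_inP=> y yC; have /cC/forall_inP := mem_setact to a xC.
  by move=> /(_ _ (mem_setact to a yC)); rewrite !le_act.
case/imsetP=> {}x xC ->; apply/forall_inP=> _ /imsetP[y yC ->].
by rewrite !le_act //; have /forall_inP-> := cC x xC.
Qed.

Lemma has_rank_act C a : a \in G -> has_rank rk (cact C a) =1 has_rank rk C.
Proof.
move=> aG r; apply/has_rankP/has_rankP=> [[_ /imsetP[x xC ->]]|[x xC rx]].
  by rewrite rk_act //; exists x.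
by exists (to x a); rewrite ?rk_act //; apply: mem_setact.
Qed.

Lemma good_act A C a : a \in G -> good A (cact C a) = good A C.
Proof.
move=> aG; rewrite /good is_chain_act //; congr [&& _, _ & _].
  apply/forall_inP/forall_inP=> H x; last by case/imsetP=> y /H Ay ->; rewrite rk_act.
  by move=> xC; have := H _ (mem_setact to a xC); rewrite rk_act.
by apply: eq_forallb => r; rewrite has_rank_act.
Qed.

(** * The space of invariant cycles as an intersection of kernels *)

Definition inv_defect f : {ffun gT * {set P} -> F^o} :=
  [ffun p : gT * {set P} => if p.1 \in G then f (cact p.2 p.1) - f p.2 else 0].

Definition support_defect A f : W := [ffun C => if good A C then 0 else f C].

Definition bd_defect R f : {ffun 'I_N * {set P} -> F^o} :=
  [ffun p : 'I_N * {set P} => if R p.1 && ~~ has_rank rk p.2 p.1 then bd rk p.1 f p.2 else 0].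

(** Set to zero on chains that already contain rank [k]: there a term with [y] in [C] would return
    the value of [f] at [C] itself. *)
Definition del k f : W := [ffun C => if has_rank rk C k then 0 else bd rk k f C].

Lemma bd_linear (a : F) r f g C : bd rk r (a *: f + g) C = a * bd rk r f C + bd rk r g C.
Proof.
rewrite bdD; congr (_ + _); rewrite /bd mulr_sumr; apply: eq_bigr => y _.
by rewrite ffunE.
Qed.

Fact inv_defect_linear : linear inv_defect.
Proof.
move=> a f g; apply/ffunP=> p; rewrite !ffunE; case: ifP => _; last by rewrite scaler0 addr0.
by rewrite scalerBr opprD addrACA.
Qed.
HB.instance Definition _ := GRing.isLinear.Build F W _ _ inv_defect inv_defect_linear.

Fact support_defect_linear A : linear (support_defect A).
Proof.
move=> a f g; apply/ffunP=> p; rewrite !ffunE; case: ifP => _ //.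
by rewrite scaler0 addr0.
Qed.
HB.instance Definition _ A :=
  GRing.isLinear.Build F W _ _ (support_defect A) (support_defect_linear A).

Fact bd_defect_linear R : linear (bd_defect R).
Proof.
move=> a f g; apply/ffunP=> p; rewrite !ffunE; case: ifP => _; first exact: bd_linear.
by rewrite scaler0 addr0.
Qed.
HB.instance Definition _ R :=
  GRing.isLinear.Build F W _ _ (bd_defect R) (bd_defect_linear R).

Fact del_linear k : linear (del k).
Proof.
move=> a f g; apply/ffunP=> p; rewrite !ffunE; case: ifP => _; last exact: bd_linear.
by rewrite scaler0 addr0.
Qed.
HB.instance Definition _ k := GRing.isLinear.Build F W _ _ (del k) (del_linear k).

Definition inv_cycles A R : {vspace W} :=
  (lker (linfun inv_defect) :&: lker (linfun (support_defect A))
   :&: lker (linfun (bd_defect R)))%VS.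

Lemma inv_cyclesP A R f :
    (forall r, A r -> (r < N)%N) -> (forall r, R r -> (r < N)%N) ->
  reflect (inv_fun f /\ cycle_in le rk A R dom f) (f \in inv_cycles A R).
Proof.
move=> AN RN; rewrite !memv_cap !memv_ker !lfunE /=.
apply: (iffP andP) => [[/andP[/eqP/ffunP i0 /eqP/ffunP s0] /eqP/ffunP b0]|[i0 [s0 b0]]].
  split=> [C a aG|]; first by have := i0 (a, C); rewrite !ffunE /= aG => /subr0_eq.
  split=> [C nf|r C Rr Cr].
    have := s0 C; rewrite !ffunE; case: ifP => [/(goodP _ AN)[cC rC] _|_ /eqP]; last first.
      by rewrite (negPf nf).
    by split=> // x xC; case: (chainP cC xC xC).
  by have := b0 (Ordinal (RN r Rr), C); rewrite !ffunE /= Rr Cr.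
split; first (apply/andP; split); apply/eqP/ffunP => p; rewrite !ffunE.
- by case: ifP => // aG; rewrite i0 // subrr.
- case: ifP => // /negP ng; have [-> //|/s0[cC rC _]] := eqVneq (f p) 0.
  by case: ng; apply/goodP.
- by case: ifP => // /andP[Rr Cr]; apply: b0.
Qed.

Lemma inv_del k f : inv_fun f -> inv_fun (del k f).
Proof.
move=> i0 C a aG; rewrite !ffunE has_rank_act //; case: ifP => // _.
rewrite /bd (reindex_inj (act_inj to a)) /=.
by apply: eq_big => [y|y _]; rewrite ?rk_act // -cactU1 i0.
Qed.

(** Boundaries at two different ranks commute, so taking the boundary at [k] keeps the zero
    boundaries at the ranks in [R]. *)
Lemma del_cycle k A A' R f :
    A =1 (fun r => (r == k) || A' r) -> ~~ A' k -> (forall r, R r -> r != k) ->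
  cycle_in le rk A R dom f -> cycle_in le rk A' R dom (del k f).
Proof.
move=> eA A'k Rk [sf kf]; split=> [D|r D fr Dr].
  rewrite ffunE; case: ifPn => [_|Dk b0]; first by rewrite eqxx.
  have [y ry fy] : exists2 y, rk y == k & f (y |: D) != 0.
    apply/exists_inP; apply: contra_neqT b0; rewrite negb_exists_in.
    by move/forall_inP=> H; apply: big1 => y /H; rewrite negbK => /eqP.
  have [cD rD uD] := sf _ fy; split.
  - apply/forall_inP=> z zD; apply/forall_inP=> w wD; apply/orP.
    by apply: (chainP cD); apply: setU1r.
  - move=> r; have := rD r; rewrite has_rankU1 (eqP ry) eA [r == k]eq_sym.
    by case: eqP => //= <- _; rewrite (negPf Dk) (negPf A'k).
  - by move=> z zD; apply/uD/setU1r.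
have nrk := Rk r fr.
rewrite /bd (eq_bigr (fun y => if has_rank rk D k then 0 else bd rk k f (y |: D))).
  have [_|Dk] := boolP (has_rank rk D k); first by rewrite big1.
  rewrite /bd exchange_big /= big1 // => y /eqP ry.
  rewrite (eq_bigr (fun z => f (z |: (y |: D)))) => [|z _]; last by rewrite setUCA.
  by apply: kf; rewrite // has_rankU1 ry eq_sym (negPf nrk).
by move=> y /eqP ry; rewrite ffunE has_rankU1 ry (negPf nrk).
Qed.

(** * Averaging over the group *)

Definition translate a f : W := [ffun C => f (cact C a)].

Lemma translate_cycle A R f a : a \in G ->
  cycle_in le rk A R dom f -> cycle_in le rk A R dom (translate a f).
Proof.
move=> aG [sf kf]; split=> [C|r C Rr Cr].
  rewrite ffunE => /sf[cC rC uC]; split; first by rewrite -(is_chain_act _ aG).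
    by move=> r; rewrite -rC has_rank_act.
  by move=> x xC; rewrite -(le_act _ _ aG) uC // mem_setact.
rewrite -(kf r (cact C a)) // ?has_rank_act // /bd [RHS](reindex_inj (act_inj to a)) /=.
by apply: eq_big => [y|y _]; rewrite ?rk_act // ffunE cactU1.
Qed.

(** The Reynolds operator, the projection onto invariant functions. *)
Definition average f : W := #|G|%:R^-1 *: \sum_(a in G) translate a f.

Lemma inv_average f : inv_fun (average f).
Proof.
move=> C a aG; rewrite !ffunE !sum_ffunE; congr (_ * _).
rewrite [RHS](reindex_inj (mulgI a)) /=.
apply: eq_big => [b|b _]; first by rewrite groupMl.
by rewrite !ffunE actM.
Qed.

Lemma cycle_inZ A R U (c : F) f :
  cycle_in le rk A R U f -> cycle_in le rk A R U (c *: f).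
Proof.
move=> [sf kf]; split=> [C|r C Rr Cr].
  rewrite ffunE; have [->|nf _] := eqVneq (f C) 0; last exact: sf.
  by rewrite scaler0 eqxx.
by rewrite -[c *: f]addr0 bd_linear kf // bd0 mulr0 addr0.
Qed.

Lemma average_cycle A R f :
  cycle_in le rk A R dom f -> cycle_in le rk A R dom (average f).
Proof.
move=> cf; apply: cycle_inZ; apply: big_ind => [||a aG].
- exact: cycle_in0.
- exact: cycle_inD.
- exact: translate_cycle.
Qed.

Lemma average_inv f : inv_fun f -> average f = f.
Proof.
move=> i0; apply/ffunP=> C; rewrite ffunE sum_ffunE (eq_bigr (fun=> f C)).
  rewrite sumr_const -scaler_nat scalerA mulVf ?scale1r //.
  by rewrite pnatr_eq0 -lt0n cardG_gt0.
by move=> a aG; rewrite ffunE i0.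
Qed.

Lemma del_average k f : del k (average f) = average (del k f).
Proof.
rewrite /average linearZ linear_sum /=; congr (_ *: _); apply: eq_bigr => a aG.
apply/ffunP=> C; rewrite !ffunE has_rank_act //; case: ifP => // _.
rewrite /bd [RHS](reindex_inj (act_inj to a)) /=.
by apply: eq_big => [y|y _]; rewrite ?rk_act // ffunE cactU1.
Qed.

(** * Rank sets and orbits of chains *)

Definition ranks T : pred nat := fun r => [exists k in T, val k == r].

Lemma ranksE T (k : 'I_N) : ranks T k = (k \in T).
Proof.
apply/exists_inP/idP=> [[j jT /eqP/val_inj <- //]|kT].
by exists k.
Qed.

Lemma ranks_lt T r : ranks T r -> (r < N)%N.
Proof. by case/exists_inP=> k _ /eqP <-; apply: ltn_ord. Qed.

Lemma ranksU T T' r : ranks (T :|: T') r = ranks T r || ranks T' r.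
Proof.
apply/exists_inP/orP=> [[k /setUP[] kT kr]|].
  by left; apply/exists_inP; exists k.
  by right; apply/exists_inP; exists k.
by case=> /exists_inP[k kT kr]; exists k; rewrite // inE kT ?orbT.
Qed.

Lemma ranks1 (k : 'I_N) r : ranks [set k] r = (r == k).
Proof.
apply/exists_inP/eqP=> [[j /set1P -> /eqP //]|->].
by exists k; rewrite ?set11.
Qed.

Definition chains T := [set C | good (ranks T) C].

Definition chain_orbits T := orbit cact G @: chains T.


Lemma chains_act T : [acts G, on chains T | cact].
Proof.
by apply/subsetP=> a aG; rewrite !inE; apply/subsetP=> C; rewrite !inE good_act.
Qed.

(** Without boundary conditions the invariant functions are those constant on orbits of chains, with
    one free value per orbit; [psi] is the resulting isomorphism. *)
Lemma dim_invariants T : \dim (inv_cycles (ranks T) pred0) = #|chain_orbits T|.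
Proof.
pose I := {O | O \in chain_orbits T}; pose m := #|{: I}|.
have mE : #|chain_orbits T| = m by rewrite /m card_sig.
pose psi (v : 'rV[F]_m) : W :=
  [ffun C => if (insub (orbit cact G C) : option I) is Some B
             then v 0 (enum_rank B) else 0].
have psi_lin : linear psi.
  move=> a u v; apply/ffunP=> C; rewrite !ffunE; case: insub => [O|].
    by rewrite !mxE.
  by rewrite scaler0 addr0.
pose psiL := HB.pack_for {linear 'rV[F]_m -> W} psi (GRing.isLinear.Build _ _ _ _ psi psi_lin).
have psiE v C : linfun psiL v C = psi v C by rewrite lfunE.
have psi_inj : (fullv :&: lker (linfun psiL) = 0)%VS.
  apply/eqP; rewrite -subv0; apply/subvP=> v; rewrite memv_cap memvf memv_ker memv0 /=.
  move=> /eqP/ffunP pv; apply/eqP/rowP=> i; rewrite mxE.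
  have /imsetP[C CT OC] := valP (enum_val i).
  by have := pv C; rewrite psiE !ffunE -OC valK enum_valK.
have -> : #|chain_orbits T| = \dim (linfun psiL @: fullv).
  by rewrite limg_dim_eq // dimvf dim_matrix mul1r.
congr (\dim _); apply/eqP; rewrite eqEsubv; apply/andP; split.
  have p0 r : pred0 r -> (r < N)%N by [].
  apply/subvP=> f /(inv_cyclesP _ (@ranks_lt T) p0)[i0 [sf _]].
  pose v : 'rV[F]_m := \row_i (if [pick C in val (enum_val i : I)] is Some C then f C else 0).
  suff -> : f = linfun psiL v by apply: memv_img; apply: memvf.
  apply/ffunP=> C; rewrite psiE ffunE; case: insubP => [O _ OC|nO].
    rewrite mxE enum_rankK; case: pickP => [D|/(_ C)]; last first.
      by rewrite /= OC orbit_refl.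
    by rewrite /= OC => /orbitP[a aG <-]; rewrite i0.
  apply/eqP; apply: contraNT nO => /sf[cC rC _]; apply: imset_f.
  by rewrite inE; apply/(goodP _ (@ranks_lt T)).
apply/subvP=> _ /memv_imgP[v _ ->]; apply/inv_cyclesP=> //; first exact: ranks_lt.
split=> [C a aG|].
  by rewrite !psiE !ffunE orbit_act.
split=> // C; rewrite psiE ffunE; case: insubP => [O|]; last by rewrite eqxx.
case/imsetP=> D DT eO _ _.
have : C \in chains T.
  have /orbitP[a aG <-] : C \in orbit cact G D by rewrite -eO orbit_refl.
  by rewrite (acts_act (chains_act T)).
rewrite inE => /(goodP _ (@ranks_lt T))[cC rC]; split=> // x xC.
by case: (chainP cC xC xC).
Qed.


Lemma inv_cycles_eq A A' R R' :
    (forall r, A r -> (r < N)%N) -> (forall r, R r -> (r < N)%N) ->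
  A =1 A' -> R =1 R' -> inv_cycles A R = inv_cycles A' R'.
Proof.
move=> AN RN eA eR; apply/vspaceP=> f.
have A'N r : A' r -> (r < N)%N by rewrite -eA; apply: AN.
have R'N r : R' r -> (r < N)%N by rewrite -eR; apply: RN.
apply/(inv_cyclesP _ AN RN)/(inv_cyclesP _ A'N R'N)=> -[i0 cf]; split=> //;
  apply: cycle_in_eq cf => // r.
  by rewrite eR.
by rewrite eR.
Qed.

(** * The dimension of invariant cycles as an alternating sum *)

Variable S : {set 'I_N}.
Hypothesis S_range : {in S, forall k : 'I_N, (0 < k < rk top)%N}.

Definition tail k := [set r in S | (k <= r)%N].

Lemma ranks_tail k : ranks (tail k) =1 from (ranks S) k.
Proof.
move=> r; apply/exists_inP/andP=> [[j]|[/exists_inP[j jS /eqP <-] kj]].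
  by rewrite inE => /andP[jS kj] /eqP <-; split=> //; apply/exists_inP; exists j.
by exists j; rewrite // inE jS.
Qed.

Lemma tail_split (k : 'I_N) : k \in S -> tail k = k |: tail k.+1.
Proof.
move=> kS; apply/setP=> r; rewrite !inE leq_eqVlt [k == r :> nat]eq_sym -val_eqE.
by case: eqP => //= /val_inj ->; rewrite kS.
Qed.

Lemma tail_skip (k : 'I_N) : k \notin S -> tail k = tail k.+1.
Proof.
move=> kS; apply/setP=> r; rewrite !inE leq_eqVlt.
by case: eqP => //= /val_inj <-; rewrite (negPf kS).
Qed.

(** Rank-nullity for [del k]: the kernel carries one more boundary condition, and by [below_lift]
    the image is the whole space of invariant cycles with rank [k] omitted. *)
Lemma dim_del (k : 'I_N) L : k \in S -> {in L, forall r : 'I_N, (r < k)%N} ->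
  \dim (inv_cycles (ranks ((k |: L) :|: tail k.+1)) (ranks (tail k.+1))) =
  (\dim (inv_cycles (ranks (L :|: tail k)) (ranks (tail k))) +
   \dim (inv_cycles (ranks (L :|: tail k.+1)) (ranks (tail k.+1))))%N.
Proof.
move=> kS Lk; rewrite -(limg_ker_dim (linfun (del k))) (tail_split kS).
have rN := @ranks_lt.
have eA : ranks ((k |: L) :|: tail k.+1) =1
    (fun r => (r == k) || ranks (L :|: tail k.+1) r).
  by move=> r; rewrite -setUA [LHS]ranksU ranks1.
have tk r : ranks (tail k.+1) r -> r != k.
  by rewrite ranks_tail => /andP[_ kr]; rewrite neq_ltn kr orbT.
have Ltk r : ranks L r -> (r < k)%N.
  by case/exists_inP=> j /Lk jk /eqP <-.
have nk : ~~ ranks (L :|: tail k.+1) k.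
  rewrite ranksU negb_or; apply/andP; split; first by apply/negP=> /Ltk; rewrite ltnn.
  by apply/negP=> /tk; rewrite eqxx.
congr addn; apply: congr1; apply/vspaceP=> f.
  rewrite memv_cap memv_ker lfunE /=.
  apply/andP/(inv_cyclesP _ (@rN _) (@rN _))
    => [[/(inv_cyclesP _ (@rN _) (@rN _))[i0 [sf kf]] /eqP/ffunP d0]|[i0 [sf kf]]].
    split=> //; split=> [C /sf[cC rC uC]|r C]; first by split=> // r; rewrite rC setUCA setUA.
    rewrite ranksU ranks1 => /orP[/eqP -> Ck|fr Cr]; last exact: kf.
    by have := d0 C; rewrite !ffunE (negPf Ck).
  split; first (apply/(inv_cyclesP _ (@rN _) (@rN _)); split=> //;
                split=> [C /sf[cC rC uC]|r C fr Cr]).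
  - by split=> // r; rewrite rC setUCA setUA.
  - by apply: kf; rewrite // ranksU fr orbT.
  apply/eqP/ffunP=> C; rewrite !ffunE; case: ifPn => // Ck.
  by apply: kf; rewrite // ranksU ranks1 eqxx.
apply/memv_imgP/(inv_cyclesP _ (@rN _) (@rN _))
  => [[g /(inv_cyclesP _ (@rN _) (@rN _))[i0 cg] ->]|[i0 cf]].
  rewrite lfunE; split; first exact: inv_del.
  exact: del_cycle eA nk tk cg.
have cf' : cycle_in le rk (fun r => ranks L r || from (ranks S) k.+1 r)
    (from (ranks S) k.+1) dom f.
  apply: cycle_in_eq cf => // r; first by rewrite ranksU ranks_tail.
  by rewrite ranks_tail.
have S_lt r : ranks S r -> (r < rk top)%N.
  by case/exists_inP=> j /S_range/andP[_ jt] /eqP <-.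
have [g cg bg] := below_lift smP S_lt (S_range kS) Ltk cf'.
have cg' : cycle_in le rk (ranks ((k |: L) :|: tail k.+1)) (ranks (tail k.+1)) dom g.
  apply: cycle_in_eq cg => // r; last by rewrite ranks_tail.
  by rewrite eA ranksU ranks_tail.
(* The lift [g] need not be invariant, but its average is; averaging commutes with [del k] and fixes
   the invariant [f]. *)
exists (average g).
  by apply/(inv_cyclesP _ (@rN _) (@rN _)); split; [exact: inv_average | exact: average_cycle].
rewrite lfunE /= del_average.
have -> : del k g = f; last by rewrite average_inv.
apply/ffunP=> C; rewrite ffunE; case: ifPn => Ck; last exact: bg.
have [//|nf] := eqVneq (f C) 0; have [_ rC _] := cf.1 C nf.
by move: Ck; rewrite rC (negPf nk).
Qed.

(** Boundary conditions are imposed from the highest rank downwards. Solving [dim_del] for the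
    kernel gives the two halves of the sum, over [T] with and without [k]. *)
Lemma dim_inv_cycles_tail (R : pzRingType) k L : {in L, forall r : 'I_N, (r < k)%N} ->
  (\dim (inv_cycles (ranks (L :|: tail k)) (ranks (tail k))))%:R =
  \sum_(T : {set 'I_N} | T \subset tail k)
     (-1) ^+ #|tail k :\: T| * #|chain_orbits (L :|: T)|%:R :> R.
Proof.
have [m] := ubnP (N - k)%N; elim: m k L => // m IHm k L lem Lk.
have [kN|Nk] := ltnP k N; last first.
  have -> : tail k = set0.
    by apply/setP=> r; rewrite !inE leqNgt (leq_trans (ltn_ord r) Nk) andbF.
  rewrite (big_pred1 set0) => [|T]; last exact: subset0.
  rewrite setD0 cards0 expr0 mul1r !setU0 -dim_invariants; congr (\dim _)%:R.
  apply: inv_cycles_eq => // r; try exact: ranks_lt.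
  by apply/exists_inP=> -[j]; rewrite inE.
have lem' : (N - k.+1 < m)%N by move: lem kN; lia.
have Lk' : {in L, forall r : 'I_N, (r < k.+1)%N} by move=> r /Lk/ltnW.
have [kS|kS] := boolP (Ordinal kN \in S); last by rewrite (tail_skip kS) IHm.
have /(congr1 (fun d => d%:R : R)) := dim_del kS Lk; rewrite natrD /=.
rewrite (IHm k.+1 L) // (IHm k.+1 (Ordinal kN |: L)) //; last first.
  by move=> r /setU1P[->|/Lk'].
move/eqP; rewrite -subr_eq => /eqP <-.
have ntk : Ordinal kN \notin tail k.+1 by rewrite inE ltnn andbF.
rewrite (tail_split kS) sum_subsets_setU1 //= addrC -sumrN; congr (_ + _).
  apply: eq_bigr => T sT; rewrite -mulNr; congr (_ * _).
  have kT : Ordinal kN \notin T by apply: contra ntk => /(subsetP sT).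
  have -> : (Ordinal kN |: tail k.+1) :\: T = Ordinal kN |: (tail k.+1 :\: T).
    by rewrite setDUl; congr (_ :|: _); apply/setDidPl; rewrite disjoints1.
  by rewrite cardsU1 in_setD (negPf ntk) andbF add1n exprS mulN1r.
apply: eq_bigr => T sT; congr (_ * #|chain_orbits _|%:R).
  congr (_ ^+ _); apply: eq_card => r; rewrite !inE; have [->|//] := eqVneq r (Ordinal kN).
  by rewrite ltnn !andbF.
by rewrite setUCA setUA.
Qed.

Theorem dim_inv_cycles (R : pzRingType) :
  (\dim (inv_cycles (ranks S) (ranks S)))%:R =
  \sum_(T : {set 'I_N} | T \subset S)
     (-1) ^+ #|S :\: T| * #|chain_orbits T|%:R :> R.
Proof.
have t0 : tail 0 = S by apply/setP=> r; rewrite inE leq0n andbT.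
have := @dim_inv_cycles_tail R 0 set0; rewrite set0U t0 => -> //; last first.
  by move=> r; rewrite inE.
by apply: eq_bigr => T _; rewrite set0U.
Qed.

Lemma sum_orbit_average f C0 :
  \sum_(C in orbit cact G C0) average f C = \sum_(C in orbit cact G C0) f C.
Proof.
rewrite (eq_bigr (fun C => #|G|%:R^-1 *: \sum_(a in G) translate a f C)); last first.
  by move=> C _; rewrite ffunE sum_ffunE.
rewrite -scaler_sumr exchange_big /= (eq_bigr (fun=> \sum_(C in orbit cact G C0) f C)).
  by rewrite sumr_const -scaler_nat scalerA mulVf ?scale1r // pnatr_eq0 -lt0n cardG_gt0.
move=> a aG; rewrite [RHS](reindex_inj (act_inj cact a)) /=.
apply: eq_big => [C|C _]; last by rewrite ffunE.
by rewrite (orbit_actr cact).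
Qed.

(** Averaging keeps the sum over an orbit, so a cycle with nonzero orbit sum has a nonzero
    average. *)
Lemma dim_inv_cycles_gt0 f C0 : cycle_in le rk (ranks S) (ranks S) dom f ->
  \sum_(C in orbit cact G C0) f C != 0 ->
  (0 < \dim (inv_cycles (ranks S) (ranks S)))%N.
Proof.
move=> cf; rewrite -sum_orbit_average => nz; rewrite lt0n dimv_eq0.
apply: contra nz => /eqP i0; have : average f \in inv_cycles (ranks S) (ranks S).
  apply/inv_cyclesP; try exact: ranks_lt.
  by split; [exact: inv_average | exact: average_cycle].
rewrite i0 memv0 => /eqP ->; rewrite big1 // => C _; exact: ffunE.
Qed.

End InvariantCycles.

(** * The partition lattice *)

Section PartitionSemimodular.

Variable n : nat.
Notation part := {set {set 'I_n}}.
Implicit Types (x y z : part) (i j v : 'I_n).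

Definition partition_le x y := [&& set_partition x, set_partition y & refines x y].

Definition same x i j := pblock x i == pblock x j.

(** Partitions are presented by maps, so that [same] becomes an equation between values and blocks
    are counted by the image. *)
Definition fibers (T : eqType) (f : 'I_n -> T) : part :=
  preim_partition f [set: 'I_n].

Lemma fibers_partition (T : eqType) (f : 'I_n -> T) : set_partition (fibers f).
Proof. exact: preim_partitionP. Qed.

Lemma mem_cover_partition x i : set_partition x -> i \in cover x.
Proof. by move/cover_partition->; rewrite inE. Qed.

Lemma same_mem x i j : set_partition x -> same x i j = (j \in pblock x i).
Proof.
move=> px; rewrite /same eq_pblock ?mem_cover_partition //.
by case/and3P: px.
Qed.

Lemma same_fibers (T : eqType) (f : 'I_n -> T) i j :
  same (fibers f) i j = (f i == f j).
Proof.
rewrite same_mem ?fibers_partition // pblock_equivalence_partition ?inE //.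
by split=> // /eqP->.
Qed.

Lemma fibers_pblock x : set_partition x -> fibers (pblock x) = x.
Proof. exact: preim_partition_pblock. Qed.

Lemma eq_fibers (T T' : eqType) (f : 'I_n -> T) (g : 'I_n -> T') :
  (forall i j, (f i == f j) = (g i == g j)) -> fibers f = fibers g.
Proof.
move=> efg; apply: eq_imset => i; apply/setP=> j; rewrite !inE /=.
exact: efg.
Qed.

Lemma eq_same x y : set_partition x -> set_partition y ->
  same x =2 same y -> x = y.
Proof.
move=> px py exy; rewrite -(fibers_pblock px) -(fibers_pblock py).
exact: eq_fibers.
Qed.

Lemma fiber_mem (T : eqType) (f : 'I_n -> T) (B : {set 'I_n}) :
  reflect (exists i, B = [set j | f i == f j]) (B \in fibers f).
Proof.
apply: (iffP imsetP) => [[i _ ->]|[i ->]]; exists i => //.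
  by apply/setP=> j; rewrite !inE.
by apply/setP=> j; rewrite !inE.
Qed.

Lemma card_fibers (T : finType) (f : 'I_n -> T) :
  #|fibers f| = #|f @: [set: 'I_n]|.
Proof.
have -> : fibers f = [set [set j | y == f j] | y in f @: [set: 'I_n]].
  apply/setP=> B; apply/fiber_mem/imsetP=> [[i ->]|[_ /imsetP[i _ ->] ->]].
    by exists (f i); rewrite ?imset_f.
  by exists i.
rewrite card_in_imset // => _ _ /imsetP[i _ ->] /imsetP[j _ ->] /setP/(_ j).
by rewrite !inE eqxx => /eqP.
Qed.

Lemma refinesP x y : set_partition x -> set_partition y ->
  reflect (forall i j, same x i j -> same y i j) (refines x y).
Proof.
move=> px py; apply: (iffP forall_inP) => [rxy i j|sxy A Ax].
  rewrite !same_mem // => jx.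
  have /exists_inP[B yB /subsetP sB] := rxy _ (pblock_mem (mem_cover_partition i px)).
  have iB : i \in B by apply: sB; rewrite mem_pblock mem_cover_partition.
  by rewrite (def_pblock _ yB iB) ?sB //; case/and3P: py.
have [i iA] : exists i, i \in A.
  by apply/set0Pn; apply: contraTneq Ax => ->; case/and3P: px.
apply/exists_inP; exists (pblock y i); first exact/pblock_mem/mem_cover_partition.
apply/subsetP=> j jA; rewrite -same_mem //; apply: sxy.
by rewrite same_mem // (def_pblock _ Ax iA) //; case/and3P: px.
Qed.

Lemma partition_leP x y :
  reflect [/\ set_partition x, set_partition y & forall i j, same x i j -> same y i j]
          (partition_le x y).
Proof.
apply: (iffP and3P) => -[px py sxy]; split=> //.
  exact/(refinesP px py).
exact/(refinesP px py).
Qed.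

Lemma card_partition_le x : set_partition x -> (#|x| <= n)%N.
Proof.
move=> px; rewrite -(fibers_pblock px) card_fibers.
by rewrite (leq_trans (leq_imset_card _ _)) // cardsT card_ord.
Qed.

Lemma card_refines x y : partition_le x y -> (#|y| <= #|x|)%N.
Proof.
case/partition_leP=> px py sxy.
rewrite -(fibers_pblock px) -(fibers_pblock py) !card_fibers.
(* [f] sends a block of [x] to the block of [y] around it, read off at any point; the default [set0]
   is reached only by the empty set. *)
pose f (B : {set 'I_n}) := if [pick i in B] is Some i then pblock y i else set0.
suff -> : pblock y @: [set: 'I_n] = f @: (pblock x @: [set: 'I_n]).
  exact: leq_imset_card.
rewrite -imset_comp; apply: eq_imset => i /=; rewrite /f.
case: pickP => [j|/(_ i)]; last first.
  by rewrite /= mem_pblock mem_cover_partition.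
by rewrite /= -same_mem // => /sxy/eqP.
Qed.

(** The smallest coarsening of [x] that relates [i] and [j]: the block of [j] takes the label of the
    block of [i]. *)
Definition join_points x i j : part :=
  fibers (fun v => if same x v j then pblock x i else pblock x v).

Lemma same_join_points x i j :
  [/\ forall u v, same x u v -> same (join_points x i j) u v,
      same (join_points x i j) i j &
      forall z, set_partition z -> (forall u v, same x u v -> same z u v) ->
        same z i j -> forall u v, same (join_points x i j) u v -> same z u v].
Proof.
split=> [u v|| z pz sxz sij u v].
- by rewrite same_fibers /same => /eqP ->.
- by rewrite same_fibers /same eqxx; case: ifP.
- have zE a b : same x a b -> pblock z a = pblock z b by move/sxz/eqP.
  have zij := eqP sij.
  have sxC a b : same x a b = same x b a by rewrite /same eq_sym.
  rewrite same_fibers /same -/(same x u j) -/(same x v j).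
  case: ifP => [/zE uj|_]; case: ifP => [/zE vj|_].
  + by rewrite uj vj.
  + by move/zE; rewrite uj -zij => ->.
  + by move/zE; rewrite vj zij => ->.
  + by move/zE => ->.
Qed.

Lemma card_join_points x i j : set_partition x -> ~~ same x i j ->
  #|x| = #|join_points x i j|.+1.
Proof.
move=> px nij; rewrite -{1}(fibers_pblock px) !card_fibers.
rewrite (cardsD1 (pblock x j) (pblock x @: _)) imset_f ?inE // add1n; congr _.+1.
apply: eq_card => B; rewrite !inE; apply/andP/imsetP=> [[nB /imsetP[v _ eB]]|[v _]].
  by exists v => //; rewrite /same -eB (negPf nB).
case: ifP => [_ ->|/negbT nvj ->]; last by split=> //; apply: imset_f.
by split=> //; apply: imset_f.
Qed.

Lemma rank_join_points x i j : set_partition x -> ~~ same x i j ->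
  partition_rank (join_points x i j) = (partition_rank x).+1.
Proof.
move=> px nij; rewrite /partition_rank.
have := card_join_points px nij; have := card_partition_le px; lia.
Qed.

Lemma partition_le_join_points x i j : set_partition x ->
  partition_le x (join_points x i j).
Proof.
move=> px; have [s _ _] := same_join_points x i j.
by apply/partition_leP; split=> //; apply: fibers_partition.
Qed.

Lemma join_points_le x z i j :
  partition_le x z -> same z i j -> partition_le (join_points x i j) z.
Proof.
case/partition_leP=> px pz sxz sij; have [_ _ s] := same_join_points x i j.
by apply/partition_leP; split=> //; [apply: fibers_partition | apply: s].
Qed.

Lemma partition_le_rank x y :
  partition_le x y -> (partition_rank x <= partition_rank y)%N.
Proof. by move/card_refines=> ?; rewrite leq_sub2l. Qed.

Lemma partition_le_ex x z : partition_le x z -> x != z ->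
  exists i j, same z i j /\ ~~ same x i j.
Proof.
case/partition_leP=> px pz sxz nxz.
have [/existsP[i /existsP[j /andP[zij xij]]]|] :=
    boolP [exists i, exists j, same z i j && ~~ same x i j].
  by exists i, j.
rewrite negb_exists => /forallP H; case/eqP: nxz; apply: eq_same => // i j.
apply/idP/idP=> [/sxz //|zij]; have := H i; rewrite negb_exists => /forallP/(_ j).
by rewrite zij negbK.
Qed.

Lemma partition_le_trans : transitive partition_le.
Proof.
move=> y x z /partition_leP[px py sxy] /partition_leP[_ pz syz].
by apply/partition_leP; split=> // i j /sxy/syz.
Qed.

Lemma partition_le_lt x y : partition_le x y -> x != y ->
  (partition_rank x < partition_rank y)%N.
Proof.
move=> lxy nxy; have [i [j [yij xij]]] := partition_le_ex lxy nxy.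
have [px _ _] := partition_leP _ _ lxy.
by rewrite -(rank_join_points px xij); apply/partition_le_rank/join_points_le.
Qed.

Lemma partition_le_refl x : partition_le x x = set_partition x.
Proof. by apply/partition_leP/idP=> [[]|px]. Qed.

Hypothesis n_gt0 : (0 < n)%N.

Lemma bottom_fibers : bottom_partition n = fibers id.
Proof.
apply/setP=> B; apply/imsetP/fiber_mem=> [[i _ ->]|[i ->]]; exists i => //.
  by apply/setP=> j; rewrite !inE eq_sym.
by apply/setP=> j; rewrite !inE eq_sym.
Qed.

Lemma top_fibers : top_partition n = fibers (fun _ => tt).
Proof.
apply/setP=> B; rewrite inE; apply/eqP/fiber_mem=> [->|[i ->]].
  by exists (Ordinal n_gt0); apply/setP=> j; rewrite !inE.
by apply/setP=> j; rewrite !inE.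
Qed.

Lemma rank_bottom : partition_rank (bottom_partition n) = 0%N.
Proof.
by rewrite bottom_fibers /partition_rank card_fibers imset_id cardsT card_ord subnn.
Qed.

Lemma rank_top : partition_rank (top_partition n) = n.-1.
Proof. by rewrite /partition_rank cards1 subn1. Qed.

Lemma partition_semimodular :
  semimodular partition_le (@partition_rank n) (bottom_partition n) (top_partition n).
Proof.
split.
- by move=> x y /partition_leP[px py _]; rewrite !partition_le_refl px.
- exact: partition_le_trans.
- exact: partition_le_lt.
- by rewrite partition_le_refl bottom_fibers fibers_partition.
- move=> x; rewrite partition_le_refl => px; apply/partition_leP.
  split; rewrite // bottom_fibers; first exact: fibers_partition.
  by move=> i j; rewrite same_fibers => /eqP ->; rewrite /same.
- move=> x; rewrite partition_le_refl => px; apply/partition_leP.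
  split; rewrite // top_fibers; first exact: fibers_partition.
  by move=> i j _; rewrite same_fibers.
- exact: rank_bottom.
- move=> x z lxz nxz; have [i [j [zij xij]]] := partition_le_ex lxz nxz.
  have [px _ _] := partition_leP _ _ lxz; exists (join_points x i j).
  by rewrite rank_join_points // partition_le_join_points // join_points_le.
- move=> x u v lxu lxv ru rv nuv.
  (* A cover of [x] merges two blocks: the join at a newly related pair lies below [w] and already
     has its rank. *)
  have cover w : partition_le x w -> partition_rank w = (partition_rank x).+1 ->
      exists i j, w = join_points x i j /\ ~~ same x i j.
    move=> lxw rw; have nxw : x != w.
      by apply/eqP=> exw; rewrite exw in rw; lia.
    have [i [j [wij xij]]] := partition_le_ex lxw nxw; exists i, j; split=> //.
    have lw := join_points_le lxw wij; apply/esym/eqP/negPn/negP=> /(partition_le_lt lw).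
    have [px _ _] := partition_leP _ _ lxw; rewrite rank_join_points // rw; lia.
  have [i [j [ev xij]]] := cover v lxv rv.
  have [px pu sxu] := partition_leP _ _ lxu.
  have uij : ~~ same u i j.
    apply/negP=> uij; have lvu : partition_le v u by rewrite ev join_points_le.
    have nvu : v != u by rewrite eq_sym.
    by have := partition_le_lt lvu nvu; rewrite ru rv ltnn.
  have [suw wij _] := same_join_points u i j.
  (* Merging in [u] the pair that produced [v] gives the join of [u] and [v]. *)
  exists (join_points u i j); split.
  + by rewrite rank_join_points // ru.
  + exact: partition_le_join_points.
  + rewrite ev join_points_le //; apply: partition_le_trans lxu _.
    exact: partition_le_join_points.
  + move=> z luz lvz; apply: join_points_le luz _.
    have [pv pz svz] := partition_leP _ _ lvz; apply: svz; rewrite ev.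
    by have [] := same_join_points x i j.
Qed.

End PartitionSemimodular.

(** * The multiplicity of the trivial character *)

Section Multiplicity.

Variable n : nat.
Hypothesis n_gt0 : (0 < n)%N.
Implicit Types (x y : {set {set 'I_n}}) (T S : {set 'I_n}).

Notation G := [set: 'S_n]%G.
Notation act := ('P^*^*)%act.

Lemma partition_le_act x y (s : 'S_n) : s \in G ->
  partition_le (act x s) (act y s) = partition_le x y.
Proof.
move=> _; have impl (u v : {set {set 'I_n}}) (t : 'S_n) :
    partition_le u v -> partition_le (act u t) (act v t).
  case/and3P=> pu pv uv; apply/and3P; split; try exact: set_partition_act.
  exact: refines_act.
by apply/idP/idP=> [/(impl _ _ s^-1%g)|/impl //]; rewrite !actK.
Qed.

Lemma partition_rank_actG x (s : 'S_n) : s \in G ->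
  partition_rank (act x s) = partition_rank x.
Proof. by move=> _; apply: partition_rank_act. Qed.

(** Burnside's count: the permutation character counts fixed chains, and its mean over the group is
    the number of orbits. *)
Lemma alpha_mult T :
  '[alpha T, 'chi_0] = #|orbit (chain_action n) G @: chains_of_ranks T|%:R.
Proof.
rewrite irr0 cfdotE.
have G0 : #|G|%:R != 0 :> algC by rewrite pnatr_eq0 -lt0n cardG_gt0.
apply: (mulfI G0); rewrite mulVKf // -natrM mulnC.
rewrite -(Frobenius_Cauchy (chains_of_ranks_act T)) natr_sum.
apply: eq_bigr => g gG; rewrite cfunE cfun1E gG mulr1n rmorph1 mulr1.
rewrite /mxtrace (eq_bigr (fun i => (enum_val i == chain_action n (enum_val i) g)%:R)).
  rewrite -(@big_enum_val _ _ _ _ [in chains_of_ranks T]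
              (fun C => (C == chain_action n C g)%:R)) /= -natr_sum; congr _%:R.
  rewrite -big_mkcondr sum1_card; apply: eq_card => C.
  change ((C \in chains_of_ranks T) && (C == chain_action n C g) =
          (C \in 'Fix_(chains_of_ranks T | chain_action n)[g])).
  by rewrite in_setI; congr (_ && _); rewrite inE sub1set inE eq_sym.
by move=> i _; rewrite mxE.
Qed.

(** The range excludes the ranks [0] and [n.-1] of the bottom and top partitions, so the two notions
    of chain agree. *)
Lemma chains_of_ranksE T : {in T, forall k : 'I_n, (0 < k < n.-1)%N} ->
  chains (@partition_le n) (@partition_rank n) T = chains_of_ranks T.
Proof.
move=> Tr; have rkn x : set_partition x -> (partition_rank x < n)%N.
  move=> px; rewrite /partition_rank ltn_subrL n_gt0 andbT card_gt0.
  apply/set0Pn; exists (pblock x (Ordinal n_gt0)).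
  by apply: pblock_mem; apply: mem_cover_partition.
apply/setP=> C; rewrite !inE.
apply/(goodP _ _ _ (@ranks_lt _ T))/andP=> [[cC rC]|[/andP[/forall_inP pC /forall_inP cC] /eqP rC]].
  split; first apply/andP; first split.
  - apply/forall_inP=> x xC.
    have px : set_partition x by case: (chainP cC xC xC); rewrite partition_le_refl.
    have rx : ranks T (partition_rank x) by rewrite -rC has_rank_mem.
    have /andP[r0 r1] : (0 < partition_rank x < n.-1)%N.
      by case/exists_inP: rx => k /Tr + /eqP <-.
    apply/and3P; split=> //; apply: contraTneq r0 => xE.
      by rewrite xE rank_bottom.
    by rewrite xE rank_top ltnn in r1.
  - apply/forall_inP=> x xC; apply/forall_inP=> y yC.
    by case: (chainP cC xC yC) => /and3P[_ _ ->]; rewrite ?orbT.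
  - apply/eqP/setP=> k; rewrite inE -ranksE -rC.
    by apply/exists_inP/has_rankP=> -[x xC /eqP]; exists x => //; apply/eqP.
have ppC x : x \in C -> set_partition x by move=> /pC/and3P[].
split.
  apply/forall_inP=> x xC; apply/forall_inP=> y yC.
  by rewrite /partition_le !ppC //= ; have /forall_inP-> := cC x xC.
move=> r; apply/has_rankP/exists_inP=> [[x xC <-]|[k]].
  exists (Ordinal (rkn x (ppC x xC))) => //.
  by rewrite -rC inE; apply/exists_inP; exists x.
by rewrite -rC inE => /exists_inP[x xC /eqP xk] /eqP <-; exists x.
Qed.

(** Both sides are the same alternating sum of numbers of orbits. *)
Lemma trivial_multE S : {in S, forall k : 'I_n, (0 < k < n.-1)%N} ->
  trivial_mult S =
  (\dim (inv_cycles (@partition_le n) (@partition_rank n) G act algC n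
           (ranks S) (ranks S)))%:R.
Proof.
move=> Sr; have Sr' : {in S, forall k : 'I_n, (0 < k < partition_rank (top_partition n))%N}.
  by move=> k /Sr; rewrite rank_top.
rewrite (dim_inv_cycles algC (partition_semimodular n_gt0) partition_le_act
           partition_rank_actG Sr' algC).
rewrite /trivial_mult /beta cfdot_suml; apply: eq_bigr => T sTS.
rewrite cfdotZl alpha_mult -chains_of_ranksE //.
by move=> k /(subsetP sTS)/Sr.
Qed.

Lemma trivial_mult_gt0 S (f : {ffun {set {set {set 'I_n}}} -> algC^o}) C0 :
    {in S, forall k : 'I_n, (0 < k < n.-1)%N} ->
    cycle_in (@partition_le n) (@partition_rank n) (ranks S) (ranks S)
      (fun x => partition_le x x) f ->
    \sum_(C in orbit (chain_action n) G C0) f C != 0 ->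
  0 < trivial_mult S.
Proof.
move=> Sr cf nz; rewrite trivial_multE // ltr0n.
exact: (dim_inv_cycles_gt0 partition_le_act partition_rank_actG cf nz).
Qed.

End Multiplicity.

(** * Partitions into the components of a forest *)

Section Forest.

Variables (n : nat) (par : 'I_n -> 'I_n).
Implicit Types (E B : {set 'I_n}) (u v w : 'I_n).

(* The edge joining [v] to [par v] is encoded by its child [v]. *)
Definition climb E v := if v \in E then par v else v.

(** When parents have smaller indices, [n] steps reach the top of the component; a vertex outside
    [E] is its own root. *)
Definition root E v := iter n (climb E) v.

Definition forest_partition E := fibers (root E).

Definition touched E := E :|: par @: E.

Hypothesis par_lt : forall v, (0 < v)%N -> (par v < v)%N.

Definition rooted E := {in E, forall v : 'I_n, (0 < v)%N}.

Lemma iter_climb_out E v m : v \notin E -> iter m (climb E) v = v.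
Proof. by move=> vE; elim: m => //= m ->; rewrite /climb (negPf vE). Qed.

Lemma root_out E v : v \notin E -> root E v = v.
Proof. exact: iter_climb_out. Qed.

Lemma root_notin E v : rooted E -> root E v \notin E.
Proof.
move=> rE; suff H m : (v <= m)%N -> iter m (climb E) v \notin E by apply/H/ltnW.
elim: m v => [|m IHm] v vm /=.
  by apply/negP=> /rE; rewrite ltnNge vm.
rewrite -iterS iterSr; have [vE|vE] := boolP (v \in E).
  rewrite /climb vE; apply: IHm; have := par_lt (rE v vE); lia.
by rewrite -iterSr iter_climb_out.
Qed.

Lemma root_climb E v : rooted E -> root E (climb E v) = root E v.
Proof.
move=> rE; rewrite {1}/root -iterSr iterS -/(root E v) /climb.
by rewrite (negPf (root_notin v rE)).
Qed.

Lemma root_par E v : rooted E -> v \in E -> root E (par v) = root E v.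
Proof. by move=> rE vE; rewrite -[RHS]root_climb // /climb vE. Qed.

(** The roots are exactly the vertices outside [E], so each edge removes one block. *)
Lemma forest_rank E : rooted E -> partition_rank (forest_partition E) = #|E|.
Proof.
move=> rE; rewrite /partition_rank card_fibers.
have -> : root E @: [set: 'I_n] = ~: E.
  apply/setP=> v; rewrite inE; apply/imsetP/idP=> [[w _ ->]|vE].
    exact: root_notin.
  by exists v; rewrite ?root_out.
by rewrite -{1}(card_ord n) -(cardsC E) addnK.
Qed.

Lemma forest_le E E' : rooted E' -> E \subset E' ->
  partition_le (forest_partition E) (forest_partition E').
Proof.
move=> rE' /subsetP sE; apply/partition_leP; split; try exact: fibers_partition.
have rr v m : root E' (iter m (climb E) v) = root E' v.
  elim: m => //= m <-; set w := iter m _ _; rewrite {1}/climb.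
  by case: ifP => // /sE; apply: root_par.
by move=> u v; rewrite !same_fibers => /eqP e; rewrite -(rr u n) -(rr v n) -/(root E u) e.
Qed.

(** Closure under children lets the climb from any [v] with root [p] be retraced inside [B]. *)
Lemma forest_block E B p : rooted E -> p \in B -> p \notin E ->
    {in B, forall v, root E v = p} ->
    (forall v, v \in E -> par v \in B -> v \in B) ->
  B \in forest_partition E.
Proof.
move=> rE pB pE rB clB; apply/fiber_mem; exists p; apply/setP=> v; rewrite !inE.
rewrite (root_out pE); apply/idP/eqP=> [/rB //|rv].
suff back m : iter m (climb E) v \in B -> v \in B by apply: (back n); rewrite -/(root E v) -rv.
elim: m => // m IHm; rewrite iterS => vB; apply: IHm.
by move: vB; rewrite {1}/climb; case: ifP => // wE; apply: clB.
Qed.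

(** Makes the isolated points an invariant of the partition, whatever forest produced it. *)
Lemma singleton_block E v : rooted E ->
  ([set v] \in forest_partition E) = (v \notin touched E).
Proof.
move=> rE; apply/idP/idP=> [/fiber_mem[w vE]|].
  have key u : u \in E -> root E w = root E u -> False.
    move=> uE wu; have := par_lt (rE u uE).
    have /set1P e1 : u \in [set v] by rewrite vE inE wu.
    have /set1P e2 : par u \in [set v] by rewrite vE inE root_par // wu.
    by rewrite e2 e1 ltnn.
  have wv : root E w = root E v.
    by apply/eqP; have := set11 v; rewrite vE inE.
  apply/negP=> /setUP[vE'|/imsetP[u uE vu]]; first exact: (key v vE' wv).
  by apply: (key u uE) => //; rewrite wv vu root_par.
rewrite inE negb_or => /andP[vE vpar].
apply: (forest_block rE (set11 v) vE) => [u /set1P ->|u uE /set1P uv].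
  exact: root_out.
by case/negP: vpar; rewrite -uv; apply: imset_f.
Qed.

Lemma pair_block E p q : rooted E -> q \in E -> par q = p -> p \notin E ->
    (forall v, v \in E -> par v = p -> v = q) -> (forall v, v \in E -> par v != q) ->
  [set p; q] \in forest_partition E.
Proof.
move=> rE qE qp pE onlyq leafq; apply: (forest_block rE (set21 p q) pE).
  move=> v /set2P[] ->; first exact: root_out.
  by rewrite -(root_par rE qE) qp root_out.
move=> v vE /set2P[/(onlyq v vE) ->|/eqP e]; first exact: set22.
by case/negP: (leafq v vE).
Qed.

Lemma block_par E B v : rooted E -> B \in forest_partition E ->
  v \in E -> v \in B -> par v \in B.
Proof. by move=> rE /fiber_mem[w ->] vE; rewrite !inE root_par. Qed.

Lemma block_edge E B : rooted E -> B \in forest_partition E -> (1 < #|B|)%N ->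
  exists2 v, v \in B & v \in E.
Proof.
move=> rE /fiber_mem[w ->] /card_gt1P[u [v [uB vB nuv]]].
move: uB vB; rewrite !inE => /eqP wu /eqP wv.
have [uE|uE] := boolP (u \in E); first by exists u; rewrite ?inE ?wu.
have [vE|vE] := boolP (v \in E); first by exists v; rewrite ?inE ?wv.
by case/eqP: nuv; rewrite -(root_out uE) -(root_out vE) -wu.
Qed.

End Forest.

(** * A cycle with nonzero average *)

Lemma card_ord_lt n b : (b <= n)%N -> #|[set v : 'I_n | (v < b)%N]| = b.
Proof.
move=> bn; rewrite cardsE -sum1_card -(big_ord_widen n (fun=> 1%N) bn).
by rewrite sum1_card card_ord.
Qed.

Lemma card_ord_interval n a b : (b <= n)%N ->
  #|[set v : 'I_n | (a <= v < b)%N]| = (b - a)%N.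
Proof.
move=> bn; have [ab|ba] := leqP a b; last first.
  have -> : (b - a = 0)%N by lia.
  by apply/eqP; rewrite cards_eq0; apply/eqP/setP=> v; rewrite !inE; lia.
have -> : [set v : 'I_n | (a <= v < b)%N] =
    [set v : 'I_n | (v < b)%N] :\: [set v : 'I_n | (v < a)%N].
  by apply/setP=> v; rewrite !inE -leqNgt.
rewrite cardsD card_ord_lt //.
have -> : [set v : 'I_n | (v < b)%N] :&: [set v : 'I_n | (v < a)%N] =
    [set v : 'I_n | (v < a)%N].
  by apply/setP=> v; rewrite !inE; lia.
by rewrite card_ord_lt // (leq_trans ab).
Qed.

Section Cycle.

(* [nup s] is the number of ranks in [S] that exceed [i] and are at most [s]. *)
Variables (n i l : nat) (S : {set 'I_n}) (nup : nat -> nat).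

Hypothesis n_ge : (l + i + 3 <= n)%N.
Hypothesis le_il : (i <= l)%N.
Hypothesis nup_small : forall s, (s <= i)%N -> nup s = 0%N.
Hypothesis nup_large : forall s : 'I_n, s \in S -> (i < s)%N ->
  [/\ (i + 1 + nup s <= s)%N, (0 < nup s <= l)%N & (s + l + 2 <= n + nup s)%N].
Hypothesis nup_lt : forall s t : 'I_n, s \in S -> t \in S -> (i < t)%N ->
  (s < t)%N -> (nup s < nup t)%N.
Hypothesis nup_lip : forall s t, (s <= t)%N -> (nup t + s <= nup s + t)%N.
Hypothesis nup_onto : forall k, (0 < k <= l)%N ->
  exists2 s : 'I_n, s \in S & (i < s)%N /\ nup s = k.
Hypothesis S_small : forall k, (0 < k <= i)%N -> exists2 s : 'I_n, s \in S & s = k :> nat.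
Hypothesis S_range : {in S, forall k : 'I_n, (0 < k < n.-1)%N}.

Implicit Types (s t u v w : 'I_n) (pi sigma : 'S_n) (E : {set 'I_n}).

(* [0] is the centre.  For [u <= i] the vertex [u + 1] is the inner and
   [l + 2 + u] the outer vertex of leg [u]; the vertices [i + 2], ..., [l + 1]
   form the long leg, and those from [l + i + 3] on hang at the centre. *)
Definition parent_index v : nat :=
  if (v < i + 2)%N then 0 else
  if (v < l + 2)%N then (if v == (i + 2)%N :> nat then 0 else v.-1) else
  if (v < l + i + 3)%N then (v - l.+1)%N else 0.

Lemma parent_index_lt v : (parent_index v < n)%N.
Proof. by have := ltn_ord v; rewrite /parent_index; do !case: ifP => _; lia. Qed.

Definition par v : 'I_n := Ordinal (parent_index_lt v).

Lemma par_lt v : (0 < v)%N -> (par v < v)%N.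
Proof. by rewrite /= /parent_index; do !case: ifP; lia. Qed.

(* Rank [s <= i] uses [s] outer leg edges.  The [k]-th larger rank, where
   [k = nup s], uses all of them, the edges [d_0], ..., [d_(k - 1)] with children
   [1], ..., [k], and as many extra edges at the centre as the rank requires. *)
Definition edges (s : nat) : {set 'I_n} :=
  [set v : 'I_n | [|| (0 < v <= nup s)%N, (l + 2 <= v < l + 2 + minn s i.+1)%N
                    | (l + i + 3 <= v < l + 2 + s - nup s)%N]].

Lemma levels s : s \in S ->
  ((0 < s)%N /\ (s <= i)%N /\ nup s = 0%N) \/
  ((i < s)%N /\ (i + 1 + nup s <= s)%N /\ (0 < nup s <= l)%N /\ (s + l + 2 <= n + nup s)%N).
Proof.
move=> sS; have /andP[s0 _] := S_range sS; have [si|si] := leqP s i.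
  by left; rewrite nup_small.
by right; have [] := nup_large sS si.
Qed.

Lemma card_edges s : s \in S -> #|edges s| = s.
Proof.
move=> sS.
have -> : edges s = [set v : 'I_n | (1 <= v < (nup s).+1)%N] :|:
   ([set v : 'I_n | (l + 2 <= v < l + 2 + minn s i.+1)%N] :|:
    [set v : 'I_n | (l + i + 3 <= v < l + 2 + s - nup s)%N]).
  by apply/setP=> v; rewrite !inE ltnS.
rewrite !cardsU.
have -> : [set v : 'I_n | (l + 2 <= v < l + 2 + minn s i.+1)%N] :&:
    [set v : 'I_n | (l + i + 3 <= v < l + 2 + s - nup s)%N] = set0.
  by apply/setP=> v; rewrite !inE; lia.
have -> : [set v : 'I_n | (1 <= v < (nup s).+1)%N] :&:
   ([set v : 'I_n | (l + 2 <= v < l + 2 + minn s i.+1)%N] :|: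
    [set v : 'I_n | (l + i + 3 <= v < l + 2 + s - nup s)%N]) = set0.
  by apply/setP=> v; rewrite !inE; case: (levels sS); lia.
rewrite cards0 !card_ord_interval; case: (levels sS); lia.
Qed.

Lemma edges_sub s t : s \in S -> t \in S -> (s <= t)%N -> edges s \subset edges t.
Proof.
move=> sS tS st; apply/subsetP=> v; rewrite !inE.
have [->//|nst] := eqVneq s t.
have lst : (s < t)%N by rewrite ltn_neqAle st andbT.
have := @nup_lt s t sS tS; have := nup_lip st.
case: (levels sS); case: (levels tS); lia.
Qed.

(** * Edge permutations and the antisymmetrised cycle *)

Definition upper v := (0 < v <= l.+1)%N.
Definition lower v := (l + 2 <= v <= l + i + 2)%N.

(** Permutations of edge labels, not of points. The [upper] labels name the edges d_0, ..., d_l, the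
    [lower] ones the [i + 1] outer leg edges. *)
Definition swaps : {set 'S_n} :=
  [set pi : 'S_n | [forall v, if upper v then upper (pi v)
                             else if lower v then lower (pi v) else pi v == v]].

Lemma swapsP pi : reflect (forall v,
  [/\ upper (pi v) = upper v, lower (pi v) = lower v &
      ~~ upper v -> ~~ lower v -> pi v = v]) (pi \in swaps).
Proof.
have dis v : upper v -> lower v = false by rewrite /upper /lower; lia.
rewrite inE; apply: (iffP forallP) => H v; last first.
  have [-> -> e] := H v; case: ifPn => // vu; case: ifPn => // vl.
  by rewrite e.
have fwd : [/\ upper v -> upper (pi v), lower v -> lower (pi v) &
      ~~ upper v -> ~~ lower v -> pi v = v].
  have := H v; case: (boolP (upper v)) => [/dis ->|_]; first by [].
  by case: ifPn => // _ /eqP.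
have [f1 f2 f3] := fwd; split=> //.
  apply/idP/idP=> // uv; apply: contraTT uv => nv; have [lv|lv] := boolP (lower v).
    by apply/negP=> /dis; rewrite f2.
  by rewrite f3.
apply/idP/idP=> // uv; apply: contraTT uv => nv; have [lv|lv] := boolP (upper v).
  by rewrite dis ?f1.
by rewrite f3.
Qed.

Definition level pi (s : nat) := forest_partition par (pi @: edges s).

Definition chain_of pi : {set {set {set 'I_n}}} := [set level pi (val s) | s in S].

Lemma level_mem pi s : s \in S -> level pi s \in chain_of pi.
Proof. exact: (@imset_f _ _ (fun s : 'I_n => level pi (val s))). Qed.

Lemma mem_swapped pi v s : (v \in pi @: edges s) = ((pi^-1)%g v \in edges s).
Proof.
apply/imsetP/idP=> [[w ws ->]|ws]; first by rewrite permK.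
by exists ((pi^-1)%g v); rewrite ?permKV.
Qed.

Lemma swapped_rooted pi s : s \in S -> pi \in swaps -> rooted (pi @: edges s).
Proof.
move=> sS /swapsP pis v; rewrite mem_swapped; set w := (pi^-1)%g v.
have [] := pis w; have -> : pi w = v by rewrite permKV.
rewrite inE /upper /lower => u lo fixw.
have vw : ~~ (0 < w <= l.+1)%N -> ~~ (l + 2 <= w <= l + i + 2)%N -> v = w :> nat.
  by move=> nu nl; rewrite fixw.
by move: u lo vw; case: (levels sS); lia.
Qed.

Lemma level_rank pi s : s \in S -> pi \in swaps ->
  partition_rank (level pi s) = s.
Proof.
move=> sS pis; rewrite forest_rank ?card_imset ?card_edges //.
- exact: perm_inj.
- exact: par_lt.
- exact: swapped_rooted.
Qed.

Lemma level_le pi s t : s \in S -> t \in S -> (s <= t)%N -> pi \in swaps ->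
  partition_le (level pi s) (level pi t).
Proof.
move=> sS tS st pis; apply: forest_le; first exact: par_lt.
  exact: swapped_rooted.
exact/imsetS/edges_sub.
Qed.

Lemma chain_of_supported pi : pi \in swaps ->
  [/\ is_chain (@partition_le n) (chain_of pi),
      has_rank (@partition_rank n) (chain_of pi) =1 ranks S &
      {in chain_of pi, forall x, partition_le x x}].
Proof.
move=> pis; split.
- apply/forall_inP=> _ /imsetP[s sS ->]; apply/forall_inP=> _ /imsetP[t tS ->].
  by apply/orP; have [st|/ltnW ts] := leqP s t; [left|right]; apply: level_le.
- move=> r; apply/has_rankP/exists_inP=> [[_ /imsetP[s sS ->] <-]|[s sS /eqP <-]].
    by exists s; rewrite ?level_rank.
  by exists (level pi s); [apply: level_mem | apply: level_rank].
- by move=> _ /imsetP[s sS ->]; rewrite level_le.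
Qed.

Definition swap_cycle : {ffun {set {set {set 'I_n}}} -> algC^o} :=
  [ffun C => \sum_(pi in swaps) (-1) ^+ odd_perm pi * (C == chain_of pi)%:R].

(** Each rank of [S] adds at most one label of each class. For [r <= i] the outer edge added at [r]
    and the next one are told apart by level [r] alone; for larger [r] the same holds for the labels
    [nup r] and [nup r + 1]. *)
Lemma swap_at r : r \in S -> exists x y,
  [/\ x != y, upper x && upper y || lower x && lower y &
      {in S, forall s, s != r -> (x \in edges s) = (y \in edges s)}].
Proof.
move=> rS; case: (levels rS) => [[r0 [ri kr]]|[ri [rk [krl rn]]]].
  have xn : (l + 1 + r < n)%N by lia.
  have yn : (l + 2 + r < n)%N by lia.
  exists (Ordinal xn), (Ordinal yn); split.
  - by rewrite -val_eqE /=; lia.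
  - by rewrite /upper /lower /=; lia.
  - move=> s sS; rewrite -val_eqE /= => nsr; rewrite !inE /=.
    case: (levels sS); lia.
have xn : (nup r < n)%N by lia.
have yn : ((nup r).+1 < n)%N by lia.
exists (Ordinal xn), (Ordinal yn); split.
- by rewrite -val_eqE /=; lia.
- by rewrite /upper /lower /=; lia.
- move=> s sS; rewrite -val_eqE /= => nsr; rewrite !inE /=.
  have h1 := @nup_lt s r sS rS ri; have h2 := @nup_lt r s rS sS.
  case: (levels sS); lia.
Qed.

Lemma tperm_swaps x y pi : upper x && upper y || lower x && lower y ->
  pi \in swaps -> (tperm x y * pi)%g \in swaps.
Proof.
move=> xy /swapsP pis; apply/swapsP=> v; rewrite permM.
have [-> -> p3] := pis (tperm x y v).
by case: tpermP p3 xy => [->|->|_ _] // p3; rewrite /upper /lower => xy; split=> //; lia.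
Qed.

Lemma tperm_edges x y s : (x \in edges s) = (y \in edges s) ->
  tperm x y @: edges s = edges s.
Proof.
move=> xy; apply/setP=> v; rewrite mem_swapped tpermV.
by case: tpermP => [->|->|].
Qed.

Definition punctured pi r : {set {set {set 'I_n}}} :=
  [set level pi (val s) | s in S :\ r].

(** Completing [C] to the chain forces [y] to be its element of rank [r], so at most one term
    survives. *)
Lemma punctured_sum pi r C : r \in S -> pi \in swaps ->
    ~~ has_rank (@partition_rank n) C r ->
  \sum_(y | partition_rank y == r) (y |: C == chain_of pi)%:R =
  (C == punctured pi r)%:R :> algC.
Proof.
move=> rS pis Cr.
have FE : chain_of pi = level pi r |: punctured pi r.
  by rewrite /chain_of -{1}(setD1K rS) imsetU1.
have punr x : x \in punctured pi r -> partition_rank x != r.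
  by case/imsetP=> s /setD1P[nsr sS] ->; rewrite level_rank.
have Crk x : x \in C -> partition_rank x != r.
  by move=> xC; apply: contra Cr => /eqP <-; apply: has_rank_mem.
have [->|nC] := eqVneq C (punctured pi r).
  rewrite (bigD1 (level pi r)) ?level_rank //= FE eqxx big1 ?addr0 // => y.
  case/andP=> /eqP ry nyl; case: eqP => // e.
  have : y \in level pi r |: punctured pi r by rewrite -e setU11.
  by rewrite in_setU1 (negPf nyl) => /punr; rewrite ry eqxx.
rewrite big1 // => y /eqP ry; case: eqP => // e; case/eqP: nC.
have strip (D : {set {set {set 'I_n}}}) z : (forall x, x \in D -> partition_rank x != r) ->
    partition_rank z = r -> D = [set x in z |: D | partition_rank x != r].
  move=> Dr zr; apply/setP=> x; rewrite !inE.
  have [->|_] := eqVneq x z.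
    by rewrite zr eqxx andbF; apply: contraTF isT => /Dr; rewrite zr eqxx.
  by case: (boolP (x \in D)) => //= /Dr ->.
rewrite (strip C y) // e FE -strip //; exact: level_rank.
Qed.

Lemma swap_cycleP :
  cycle_in (@partition_le n) (@partition_rank n) (ranks S) (ranks S)
    (fun x => partition_le x x) swap_cycle.
Proof.
split=> [C|r C /exists_inP[s sS /eqP <-] Cs].
  rewrite ffunE => nz; have [pi pis /eqP ->] : exists2 pi, pi \in swaps & C == chain_of pi.
    apply/exists_inP; apply: contraNT nz; rewrite negb_exists_in => /forall_inP H.
    by apply/eqP/big1 => pi /H/negPf ->; rewrite mulr0.
  exact: chain_of_supported.
rewrite /bd (eq_bigr (fun y => \sum_(pi in swaps) (-1) ^+ odd_perm pi *
    (y |: C == chain_of pi)%:R)); last by move=> y _; rewrite ffunE.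
rewrite exchange_big /= (eq_bigr (fun pi => (-1) ^+ odd_perm pi *
    (C == punctured pi s)%:R)); last first.
  by move=> pi pis; rewrite -mulr_sumr punctured_sum.
have [x [y [nxy xyD xyE]]] := swap_at sS.
(* The transposition from [swap_at] reverses the sign and leaves every level other than [s]
   unchanged, so it turns [Z] into [- Z]; in characteristic zero this forces [Z = 0]. *)
set Z := \sum_(pi in swaps) _; suff : Z = - Z.
  move/eqP; rewrite -addr_eq0 -mulr2n mulrn_eq0 /= => /eqP //.
rewrite {1}/Z (reindex_inj (mulgI (tperm x y))) /= -sumrN.
apply: eq_big => [pi|pi pis].
  apply/idP/idP; last exact: tperm_swaps.
  by move/(tperm_swaps xyD); rewrite mulgA tperm2 mul1g.
rewrite odd_mul_tperm nxy addTb signrN mulNr; congr (- (_ * (_ == _)%:R)).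
apply: eq_in_imset => t /setD1P[nts tS]; rewrite /level; congr (forest_partition _ _).
rewrite -[in RHS](tperm_edges (xyE t tS nts)) -imset_comp.
by apply: eq_imset => v; rewrite /= permM.
Qed.


(** * Permuted chains in the orbit of the original one *)

Lemma swaps1 : 1%g \in swaps.
Proof. by apply/swapsP=> v; rewrite perm1. Qed.

Lemma swap_inv pi v : pi \in swaps ->
  [/\ upper ((pi^-1)%g v) = upper v, lower ((pi^-1)%g v) = lower v &
      ~~ upper v -> ~~ lower v -> (pi^-1)%g v = v].
Proof.
move=> /swapsP/(_ ((pi^-1)%g v)); rewrite permKV => -[<- <- fixv].
by split=> // nu nl; apply/esym/fixv.
Qed.

Lemma block_act (x : {set {set 'I_n}}) (B : {set 'I_n}) sigma :
  (sigma @: B \in on_partition x sigma) = (B \in x).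
Proof.
by rewrite /on_partition act_partitionE mem_imset //; apply/imset_inj/perm_inj.
Qed.

(** The action preserves rank, so a permutation of points carrying one chain to the other matches
    them level by level. *)
Lemma orbit_levels pi : pi \in swaps ->
    chain_of pi \in orbit (chain_action n) [set: 'S_n] (chain_of 1) ->
  exists sigma, {in S, forall s, on_partition (level 1 s) sigma = level pi s}.
Proof.
move=> pis /orbitP[sigma _ e]; exists sigma => s sS.
have : on_partition (level 1 s) sigma \in chain_of pi.
  by rewrite -e; apply/mem_setact/level_mem.
case/imsetP=> t tS et; rewrite et; congr (level pi _).
have := level_rank tS pis; rewrite -et partition_rank_act level_rank ?swaps1 //.
Qed.

(** Isolated points are singleton blocks, and [sigma] carries those of one partition to those of the
    other. *)
Lemma touched_card pi sigma s : s \in S -> pi \in swaps ->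
    on_partition (level 1 s) sigma = level pi s ->
  #|touched par (pi @: edges s)| = #|touched par (edges s)|.
Proof.
move=> sS pis e; rewrite -[RHS](card_imset _ (@perm_inj _ sigma)).
apply: eq_card => v; rewrite -[v](permKV sigma) mem_imset; last exact: perm_inj.
set w := (sigma^-1)%g v; apply: negb_inj.
rewrite -(singleton_block par_lt); last exact: swapped_rooted.
have e1 : edges s = (1%g : 'S_n) @: edges s.
  by apply/setP=> u; rewrite mem_swapped invg1 perm1.
rewrite e1 -(singleton_block par_lt) -?e1; last first.
  by rewrite e1; apply: swapped_rooted; rewrite // swaps1.
by rewrite -/(level pi s) -e -imset_set1 block_act /level -e1.
Qed.

(** Pattern of the two counting arguments below: [T2] exceeds [B] by at most one point, [T1] by at
    least two. *)
Lemma count_contra (T1 T2 B : {set 'I_n}) z v v' :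
  #|T1| = #|T2| -> T2 \subset z |: B -> B \subset T1 -> v \in T1 -> v' \in T1 ->
  v != v' -> v \notin B -> v' \notin B -> False.
Proof.
move=> e12 sT2 sB vT v'T nvv vB v'B.
have : (#|v |: (v' |: B)| <= #|T1|)%N.
  by apply: subset_leq_card; rewrite !subUset !sub1set vT v'T.
rewrite !cardsU1 in_setU1 negb_or nvv vB v'B e12.
move/leq_trans=> /(_ _ (subset_leq_card sT2)); rewrite cardsU1 !add1n.
by case: (z \notin B); rewrite ?add1n ?add0n ?ltnn // ltnNge leqW.
Qed.

Lemma touchedP E v : v \in touched par E ->
  v \in E \/ exists2 w, w \in E & par w = v.
Proof. by case/setUP=> [|/imsetP[w wE ->]]; [left | right; exists w]. Qed.

Lemma touched_edge E v : v \in E -> v \in touched par E.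
Proof. by move=> vE; rewrite inE vE. Qed.

Lemma touched_par E v : v \in E -> par v \in touched par E.
Proof. by move=> vE; rewrite inE imset_f ?orbT. Qed.

(** * Rigidity: inner leg edges stay inner and the long leg is fixed *)

Section Stabilised.

Variables (pi sigma : 'S_n).
Hypothesis pis : pi \in swaps.
Hypothesis levels_eq : {in S, forall s, on_partition (level 1 s) sigma = level pi s}.

Let n_gt0 : (0 < n)%N. Proof. lia. Qed.
Let zero : 'I_n := Ordinal n_gt0.

Lemma lower_mem s v : s \in S -> (i < s)%N -> lower v -> v \in pi @: edges s.
Proof.
move=> sS si lv; rewrite mem_swapped inE; have [_ + _] := swap_inv v pis.
by rewrite lv /lower; lia.
Qed.

Lemma extra_mem s v : s \in S -> (l + i + 3 <= v < l + 2 + s - nup s)%N ->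
  v \in pi @: edges s.
Proof.
move=> sS vs; rewrite mem_swapped inE; have [_ _ ->] := swap_inv v pis.
- by rewrite vs !orbT.
- by rewrite /upper; lia.
- by rewrite /lower; lia.
Qed.

Lemma upper_mem s v : (0 < nup s <= l)%N -> ((pi^-1)%g v <= nup s)%N -> upper v ->
  v \in pi @: edges s.
Proof.
move=> ks vs uv; rewrite mem_swapped inE; have [+ _ _] := swap_inv v pis.
by rewrite uv /upper => /andP[-> _]; rewrite vs.
Qed.

Lemma legs_mem s v : s \in S -> (i < s)%N -> (0 < v <= i + 1)%N ->
  v \in touched par (pi @: edges s).
Proof.
move=> sS si vi; have qn : (v + l.+1 < n)%N by lia.
have -> : v = par (Ordinal qn).
  by apply/val_inj; rewrite /= /parent_index; do !case: ifP => /=; lia.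
by apply/touched_par/lower_mem => //; rewrite /lower /=; lia.
Qed.

(** At the level with [nup s = k] the original forest touches only the legs, the extra vertices and
    the centre. The permuted forest touches the legs and the extra vertices anyway; if [pi u] were
    on the long leg, both ends of that edge would come on top. *)
Lemma legs_first k u : (0 < k <= l)%N -> (k <= i + 1)%N -> (0 < u <= k)%N ->
  (pi u <= i + 1)%N.
Proof.
move=> kl ki uk; have [s sS [si sk]] := nup_onto kl.
rewrite leqNgt; apply/negP=> piu.
have upi : upper (pi u).
  by have [+ _ _] := swapsP _ pis u; rewrite /upper; lia.
pose B := [set w : 'I_n | [|| lower w, (0 < w <= i + 1)%N |
                            (l + i + 3 <= w < l + 2 + s - nup s)%N]].
have pE : pi u \in pi @: edges s.
  by apply: imset_f; rewrite inE sk; lia.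
apply: (@count_contra _ _ B zero (pi u) (par (pi u))
          (touched_card sS pis (levels_eq sS))).
- apply/subsetP=> w /touchedP[|[x + <-]]; rewrite !inE -val_eqE /= /lower.
    by have [_ ? _] := nup_large sS si; lia.
  by rewrite /parent_index; have [_ ? _] := nup_large sS si; do !case: ifP => /=; lia.
- apply/subsetP=> w; rewrite inE => /or3P[lw|wi|wr].
  + exact/touched_edge/lower_mem.
  + exact: legs_mem.
  + exact/touched_edge/extra_mem.
- exact: touched_edge.
- exact: touched_par.
- by rewrite eq_sym -val_eqE neq_ltn par_lt //; lia.
- by move: upi; rewrite inE /lower /upper; lia.
- by move: upi; rewrite inE /lower /upper /= /parent_index; do !case: ifP => /=; lia.
Qed.

(** For [i < l] this is [legs_first] with [k = i + 1]; for [i = l] every upper label is an inner leg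
    edge. *)
Lemma legs_stable v : (0 < pi v <= i + 1)%N = (0 < v <= i + 1)%N.
Proof.
pose B := [set w : 'I_n | (0 < w <= i + 1)%N].
suff sB : pi @: B \subset B.
  have eB : pi @: B = B.
    by apply/eqP; rewrite eqEcard sB (card_imset _ (@perm_inj _ pi)) leqnn.
  by have := mem_imset B v (@perm_inj _ pi); rewrite eB /B !inE => ->.
apply/subsetP=> _ /imsetP[w + ->]; rewrite !inE => wi.
have [+ _ _] := swapsP _ pis w; have [il|li] := ltnP i l; last by rewrite /upper; lia.
have := @legs_first (i + 1) w; rewrite /upper; lia.
Qed.

(** Induction along the long leg. At the level with [nup s = k] all smaller labels are present in
    both forests. If [pi u] were beyond [k], it and its parent would both be newly touched, whereas
    the original forest adds only [u]. *)
Lemma path_fixed k u : u = k :> nat -> (i + 2 <= k <= l)%N -> pi u = u.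
Proof.
elim/ltn_ind: k u => k IHk u uk ki.
have [s sS [si sk]] : exists2 s : 'I_n, s \in S & (i < s)%N /\ nup s = k.
  by apply: nup_onto; lia.
apply/eqP/negPn/negP=> npi.
have upi : upper (pi u).
  by have [+ _ _] := swapsP _ pis u; rewrite /upper; lia.
have gt_pi : (k < pi u)%N.
  rewrite ltnNge; apply/negP=> lek; have := legs_stable u.
  have [pik|nk] := eqVneq (pi u : nat) k.
    by case/eqP: npi; apply: val_inj; rewrite /= pik uk.
  have [ge|lt] := leqP (i + 2) (pi u); last by move: upi; rewrite /upper; lia.
  have := @IHk (pi u) _ (pi u) erefl.
  move=> H; case/eqP: npi; apply: (@perm_inj _ pi); apply: H; lia.
pose B := [set w : 'I_n | [|| lower w, (w < k)%N |
                            (l + i + 3 <= w < l + 2 + s - nup s)%N]].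
have pE : pi u \in pi @: edges s.
  by apply: imset_f; rewrite inE sk; lia.
have ltk w : (0 < w < k)%N -> w \in pi @: edges s.
  move=> wk; apply: upper_mem; rewrite ?sk; [lia | | rewrite /upper; lia].
  have := legs_stable ((pi^-1)%g w); rewrite permKV.
  have [ge|lt] := leqP (i + 2) w; last by lia.
  have ew : pi w = w by apply: (@IHk w); lia.
  have -> : (pi^-1)%g w = w by rewrite -{1}ew permK.
  by lia.
apply: (@count_contra _ _ B u (pi u) (par (pi u))
          (touched_card sS pis (levels_eq sS))).
- apply/subsetP=> w /touchedP[|[x + <-]]; rewrite !inE -val_eqE /= /lower.
    by have [_ ? _] := nup_large sS si; lia.
  by rewrite /parent_index; have [_ ? _] := nup_large sS si; do !case: ifP => /=; lia.
- apply/subsetP=> w; rewrite inE => /or3P[lw|wk|wr].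
  + exact/touched_edge/lower_mem.
  + have [w0|w0] := posnP w; last by apply/touched_edge/ltk; lia.
    have n1 : (1 < n)%N by lia.
    have -> : w = par (Ordinal n1).
      by apply/val_inj; rewrite /= w0 /parent_index; do !case: ifP => /=; lia.
    by apply/touched_par/ltk => /=; lia.
  + exact/touched_edge/extra_mem.
- exact: touched_edge.
- exact: touched_par.
- by rewrite eq_sym -val_eqE neq_ltn par_lt //; lia.
- by move: upi; rewrite inE /lower /upper; lia.
- by move: upi; rewrite inE /lower /upper /= /parent_index; do !case: ifP => /=; lia.
Qed.

Lemma fixed_off_legs v : ~~ lower v -> ~~ (0 < v <= i + 1)%N -> pi v = v.
Proof.
move=> lv nv; have [uv|uv] := boolP (upper v); last first.
  by have [_ _ ->] := swapsP _ pis v.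
have [vl|lv'] := leqP v l.
  by apply: (@path_fixed v); move: uv nv; rewrite /upper; lia.
have [+ _ _] := swapsP _ pis v; rewrite uv => upv.
have := legs_stable v; rewrite (negPf nv) => npv.
apply/eqP/negPn/negP=> npi.
have nlt : (pi v <= l)%N.
  have [e|ne] := eqVneq (pi v : nat) l.+1; last by move: upv; rewrite /upper; lia.
  by case/eqP: npi; apply: val_inj; rewrite /= e; move: uv; rewrite /upper; lia.
case/eqP: npi; apply: (@perm_inj _ pi); apply: (@path_fixed (pi v)) => //.
by move: upv npv; rewrite /upper; lia.
Qed.

(** * Inner and outer leg edges undergo the same permutation *)

Lemma par_legs v : (0 < par v <= i + 1)%N -> lower v.
Proof. by rewrite /= /parent_index /lower; do !case: ifP => /=; lia. Qed.

Lemma lower_par v : lower v -> par v = (v - l.+1)%N :> nat.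
Proof. by rewrite /lower /= /parent_index; do !case: ifP => /=; lia. Qed.

Lemma par_lower_inj u v : lower u -> lower v -> par u = par v -> u = v.
Proof.
move=> lu lv /(congr1 val) /=; rewrite -!/(val (par _)) /= => e.
apply: val_inj => /=; have := lower_par lu; have := lower_par lv; rewrite /= e.
by move: lu lv; rewrite /lower; lia.
Qed.

Lemma par_not_lower v : ~~ lower (par v).
Proof. by rewrite /lower /= /parent_index; do !case: ifP => /=; lia. Qed.

(** For an outer edge [q], the label that [pi] sends to the inner edge of the leg of [pi q]. The aim
    is to show that it equals [par q], as it does for the identity. *)
Definition twist q : 'I_n := (pi^-1)%g (par (pi q)).

Lemma lower_pi q : lower (pi q) = lower q.
Proof. by have [] := swapsP _ pis q. Qed.

Lemma twist_range q : lower q -> (0 < twist q <= i + 1)%N.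
Proof.
move=> lq; have := legs_stable (twist q); rewrite permKV => <-.
by rewrite lower_par ?lower_pi //; move: lq; rewrite -lower_pi /lower; lia.
Qed.

Lemma twist_inj p q : lower p -> lower q -> twist p = twist q -> p = q.
Proof.
move=> lp lq /perm_inj e; apply: (@perm_inj _ pi).
by apply: par_lower_inj; rewrite ?lower_pi.
Qed.

(** The outer edge [pi q] is present but the inner edge of its leg is not, so the leg is a component
    with two points. *)
Lemma twist_pair s q : s \in S -> lower q -> q \in edges s -> twist q \notin edges s ->
  [set par (pi q); pi q] \in level pi s.
Proof.
move=> sS lq qs ts; have lpq : lower (pi q) by rewrite lower_pi.
apply: (pair_block par_lt).
- exact: swapped_rooted.
- exact: imset_f.
- by [].
- by rewrite mem_swapped.
- move=> v _ e; apply: par_lower_inj => //; apply: par_legs; rewrite e.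
  by rewrite lower_par //; move: lpq; rewrite /lower; lia.
- by move=> v _; apply: contraNneq (par_not_lower v) => ->.
Qed.

(* The partitions of the original chain at rank [t] and at the [t]-th rank
   above [i] share no block of size two, because the first [t] legs have joined
   the centre by then. *)
Lemma twist_le t q : (0 < t <= i)%N -> lower q -> (par q <= t)%N -> (twist q <= t)%N.
Proof.
move=> ti lq qt; rewrite leqNgt; apply/negP=> tw; have twr := twist_range lq.
have [s sS [si sk]] : exists2 s : 'I_n, s \in S & (i < s)%N /\ nup s = t.
  by apply: nup_onto; lia.
have [r rS rt] := S_small ti.
have kr : nup r = 0%N by apply: nup_small; lia.
have parq := lower_par lq; have lq' := lq; rewrite /lower in lq'.
have Br : [set par (pi q); pi q] \in level pi r.
  apply: twist_pair; rewrite // inE kr rt; lia.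
have Bs : [set par (pi q); pi q] \in level pi s.
  apply: twist_pair; rewrite // inE sk; have [_ ? ?] := nup_large sS si; lia.
pose B := (sigma^-1)%g @: [set par (pi q); pi q].
have sB : sigma @: B = [set par (pi q); pi q].
  by rewrite -imset_comp -[RHS]imset_id; apply: eq_imset => v /=; rewrite permKV.
have lev1 (k : 'I_n) : level 1 k = forest_partition par (edges k).
  by rewrite /level; congr (forest_partition _ _); apply/setP=> u; rewrite mem_swapped invg1 perm1.
have rooted1 (k : 'I_n) : k \in S -> rooted (edges k).
  move=> kS u uk; apply: (swapped_rooted kS swaps1).
  by rewrite mem_swapped invg1 perm1.
have {}Br : B \in level 1 r by rewrite -(block_act _ _ sigma) levels_eq // sB.
have {}Bs : B \in level 1 s by rewrite -(block_act _ _ sigma) levels_eq // sB.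
have npq : par (pi q) != pi q.
  by apply: contraTneq (par_not_lower (pi q)) => ->; rewrite lower_pi lq.
have B2 : #|B| = 2%N by rewrite card_imset ?cards2 ?npq //; apply: perm_inj.
rewrite !lev1 in Br Bs.
(* At rank [t] the block [B] contains the outer vertex [v] of one of the first [t] legs. At the
   later level the inner edge of that leg is present and forces a third point into [B]. *)
have [v vB vr] : exists2 v, v \in B & v \in edges r.
  by apply: (block_edge (rooted1 r rS) Br); rewrite B2.
have pvB := block_par par_lt (rooted1 r rS) Br vr vB.
have lv : lower v by move: vr; rewrite inE kr rt /lower; clear -ti; lia.
have parv := lower_par lv; rewrite /lower in lv.
have pvs : par v \in edges s.
  by rewrite inE sk parv; move: vr; rewrite inE kr rt; clear -ti; lia.
have ppvB := block_par par_lt (rooted1 s sS) Bs pvs pvB.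
have v0 : (0 < v)%N by clear -lv; lia.
have pv0 : (0 < par v)%N by rewrite parv; clear -lv; lia.
have lt1 := par_lt v0; have lt2 := par_lt pv0.
have neq (u w : 'I_n) : (u < w)%N -> w != u by rewrite -val_eqE neq_ltn orbC => ->.
have : (#|[set v; par v; par (par v)]| <= #|B|)%N.
  apply: subset_leq_card; apply/subsetP=> u; rewrite !inE.
  by case/orP=> [/orP[]|] /eqP ->.
rewrite B2 -setUA !cardsU1 cards1 !inE (negPf (neq _ _ lt1)) (negPf (neq _ _ lt2)).
by rewrite (negPf (neq _ _ (ltn_trans lt2 lt1))).
Qed.

(** [twist] is injective and never exceeds [par]. Were it smaller at [q], the outer edge with parent
    [twist q] would by induction have the same twist. *)
Lemma twist_par q : lower q -> twist q = par q.
Proof.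
move=> lq; apply: val_inj; have [m] := ubnP (par q : nat).
elim: m q lq => // m IHm q lq qm; have twr := twist_range lq; have parq := lower_par lq.
have le_tw : (twist q <= par q)%N.
  (* Legs up to [i] are settled by [twist_le]; for the last leg [twist_range] already gives the
     bound [i + 1]. *)
  have [qi|qi] := leqP (par q) i; last by lia.
  by apply: twist_le => //; move: lq; rewrite /lower parq; lia.
apply/eqP; rewrite eqn_leq le_tw leqNgt; apply/negP=> tw.
have tn : (twist q + l.+1 < n)%N by lia.
pose p := Ordinal tn; have lp : lower p by rewrite /lower /=; lia.
have parp : par p = twist q.
  by apply: val_inj; apply: etrans (lower_par lp) _; rewrite /= addnK.
have e : twist p = twist q.
  by apply: val_inj; rewrite IHm // ?parp //; apply: leq_trans tw _.
by move: tw; rewrite -(twist_inj lp lq e) parp e ltnn.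
Qed.

Definition leg v := (0 < v <= i + 1)%N.

Definition mirror v : 'I_n :=
  insubd v (if lower v then v - l.+1 else if leg v then v + l.+1 else v)%N.

Lemma val_mirror v :
  mirror v = (if lower v then v - l.+1 else if leg v then v + l.+1 else v)%N :> nat.
Proof.
rewrite val_insubd /lower /leg; have := ltn_ord v.
by do !case: ifP => //=; lia.
Qed.

Lemma mirrorK : involutive mirror.
Proof.
move=> v; apply: val_inj; rewrite /= !val_mirror /lower /leg !val_mirror /lower /leg.
by do !case: ifP => //=; lia.
Qed.

(** [pi] is the product of its action [a] on the inner leg edges and the conjugate of [a] by the
    mirror; the two factors have equal sign. *)
Lemma even_stabiliser : odd_perm pi = false.
Proof.
pose f v := if leg v then pi v else v.
have f_inj : injective f.
  move=> u v; rewrite /f.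
  have lu := legs_stable u; have lv := legs_stable v; rewrite -!/(leg _) in lu lv.
  case: ifP; case: ifP => // lu' lv' e; first exact: perm_inj e.
  - by rewrite -e lu lv' in lu'.
  - by rewrite e lv lu' in lv'.
pose a := perm f_inj; pose m := perm (inv_inj mirrorK).
suff -> : pi = (a * a ^ m)%g by rewrite odd_permM odd_permJ addbb.
have aE v : a v = f v by rewrite permE.
have mE v : m v = mirror v by rewrite permE.
have low_leg v : lower v -> leg v = false by rewrite /lower /leg; lia.
have mir_leg v : leg v -> lower (mirror v).
  by move=> lv; rewrite /lower val_mirror; move: lv; rewrite /lower /leg; do !case: ifP; lia.
have bE v : (a ^ m)%g (mirror v) = mirror (f v) by rewrite -mE permJ mE aE.
have mir_low v : lower v -> mirror v = par v.
  by move=> lv; apply: val_inj; apply: etrans (val_mirror v) _; rewrite lv -(lower_par lv).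
apply/permP=> v; rewrite permM aE /f.
have [lv|nl] := boolP (leg v).
  have lpv : leg (pi v) by rewrite /leg legs_stable.
  by rewrite -[in RHS](mirrorK (pi v)) bE /f low_leg ?mir_leg // mirrorK.
rewrite -[in RHS](mirrorK v) bE /f.
have [lo|nlo] := boolP (lower v).
  have -> : leg (mirror v).
    by rewrite mir_low // /leg lower_par //; move: lo; rewrite /lower; lia.
  rewrite (mir_low v lo) -(twist_par lo) /twist permKV -mir_low ?lower_pi //.
  by rewrite mirrorK.
have mv : mirror v = v.
  by apply: val_inj; apply: etrans (val_mirror v) _; rewrite (negPf nlo) (negPf nl).
by rewrite mv (negPf nl) mv fixed_off_legs.
Qed.

End Stabilised.

(** Only permutations whose chain lies in the orbit contribute, each with [+1], and the identity is
    one of them. *)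
Lemma swap_cycle_orbit_sum :
  \sum_(C in orbit (chain_action n) [set: 'S_n] (chain_of 1)) swap_cycle C != 0.
Proof.
pose O := orbit (chain_action n) [set: 'S_n] (chain_of 1).
rewrite (eq_bigr (fun C => \sum_(pi in swaps) (-1) ^+ odd_perm pi *
    (C == chain_of pi)%:R)); last by move=> C _; rewrite ffunE.
rewrite exchange_big /= (eq_bigr (fun pi => (chain_of pi \in O)%:R)).
  rewrite -natr_sum pnatr_eq0 -lt0n (bigD1 1%g) ?swaps1 //=.
  by rewrite orbit_refl.
move=> pi pis; rewrite -mulr_sumr.
have -> : \sum_(C in O) (C == chain_of pi)%:R = (chain_of pi \in O)%:R :> algC.
  have [piO|npiO] := boolP (chain_of pi \in O).
    rewrite (bigD1 (chain_of pi)) //= eqxx big1 ?addr0 // => C /andP[_ /negPf -> //].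
  rewrite big1 // => C CO; case: eqP => // e.
  by rewrite -e CO in npiO.
have [piO|_] := boolP (chain_of pi \in O); last by rewrite mulr0.
have [sigma levels_eq] := orbit_levels pis piO.
by rewrite (even_stabiliser pis levels_eq) expr0 mul1r.
Qed.

Lemma trivial_mult_swap_cycle : 0 < trivial_mult S.
Proof.
have n_gt0 : (0 < n)%N by lia.
exact: (trivial_mult_gt0 n_gt0 S_range swap_cycleP swap_cycle_orbit_sum).
Qed.

End Cycle.

(** * Counting the members of the given sequence *)

Lemma count_interval (js : seq nat) (p : pred nat) a b : uniq js ->
  {in js, forall x, p x -> (a <= x < b)%N} -> (count p js <= b - a)%N.
Proof.
move=> ujs sub; rewrite -size_filter -[leqRHS](size_iota a).
apply: uniq_leq_size; first exact: filter_uniq.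
move=> x; rewrite mem_filter mem_iota => /andP[px xj]; have := sub x xj px; lia.
Qed.

Lemma count_leq_split (js : seq nat) s t : (s <= t)%N ->
  count (leq^~ t) js = (count (leq^~ s) js + count (fun x => s < x <= t)%N js)%N.
Proof.
move=> st; rewrite -count_predUI [X in (_ + X)%N](_ : _ = 0%N) ?addn0.
  by apply: eq_count => x /=; lia.
by apply/eqP; rewrite -leqn0 leqNgt -has_count; apply/hasPn=> x _ /=; lia.
Qed.

Theorem theorem2p2 (n i l : nat) (j : l.-tuple nat) (S : {set 'I_n}) :
  (3 <= n)%N ->
  (* i < j_1 < ... < j_l *)
  path ltn i j ->
  (* j_1 - i > 1 (void when there is no j_1) *)
  ((0 < l)%N -> (1 < nth 0%N j 0 - i)%N) ->
  (* {1, ..., i, j_1, ..., j_l} is contained in {1, ..., n-2} *)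
  (forall k : nat, (1 <= k <= i)%N || (k \in j) -> (1 <= k <= n - 2)%N) ->
  (* S = {1, ..., i, j_1, ..., j_l} *)
  (forall k : 'I_n, (k \in S) = (1 <= k <= i)%N || (nat_of_ord k \in j)) ->
  (i <= l)%N ->
  (0 < trivial_mult S)%R.
Proof.
move=> n3 pj gap range memS il.
pose nup s := count (leq^~ s) j.
have sj : sorted ltn j := path_sorted pj.
have uj : uniq j := sorted_uniq ltn_trans ltnn sj.
have sz := size_tuple j.
(* The gap at the first member puts the whole sequence at [i + 2] or later. *)
have jlarge x : x \in j -> (i + 2 <= x <= n - 2)%N.
  move=> xj; have /andP[_ xn] : (1 <= x <= n - 2)%N by apply: range; rewrite xj orbT.
  rewrite xn andbT; have l0 : (0 < l)%N by rewrite -sz -has_predT; apply/hasP; exists x.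
  have ix : (index x j < size j)%N by rewrite index_mem.
  have : (nth 0 j 0 <= nth 0 j (index x j))%N.
    have [->//|i0] := posnP (index x j); apply/ltnW.
    by apply: (sorted_ltn_nth ltn_trans 0%N sj); rewrite ?inE //; apply: leq_ltn_trans ix.
  by rewrite nth_index //; have := gap l0; lia.
have nup_split s t := @count_leq_split j s t.
have kk0 s : (s <= i)%N -> nup s = 0%N.
  move=> si; apply/eqP; rewrite -leqn0 leqNgt -has_count; apply/hasPn=> x /jlarge.
  by rewrite /=; lia.
have memj (s : 'I_n) : s \in S -> (i < s)%N -> nat_of_ord s \in j.
  by rewrite memS => /orP[|//]; lia.
have nup_step s t : (s < t)%N -> t \in j -> (nup s < nup t)%N.
  move=> st tj; rewrite /nup (nup_split s t (ltnW st)) -[X in (X < _)%N]addn0.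
  rewrite ltn_add2l -has_count.
  by apply/hasP; exists t; rewrite // st leqnn.
have nup_l s : (nup s <= l)%N by rewrite /nup -[leqRHS]sz count_size.
have n_ge : (l + i + 3 <= n)%N.
  (* For [l = 0] the bound [i <= l] leaves [i = 0], and the claim is [3 <= n]. Otherwise the [l]
     distinct members fit between [i + 2] and [n - 2]. *)
  have [l0|l0] := posnP l; first by lia.
  have := @count_interval j predT (i + 2) (n - 1) uj.
  rewrite count_predT sz => H; suff: (l <= n - 1 - (i + 2))%N by lia.
  by apply: H => x /jlarge; lia.
apply: (@trivial_mult_swap_cycle n i l S nup) => //.
- move=> s sS si; have sj' := memj s sS si; have := jlarge s sj' => s2.
  have nup_pos : (0 < nup s)%N by rewrite -(kk0 i (leqnn i)); apply: nup_step.
  split; last 1 first.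
  (* The [l - nup s] members beyond [s] fit between [s + 1] and [n - 2]. *)
  + have : (count (fun x => s < x <= n - 2)%N j <= n - 1 - s.+1)%N.
      by apply: count_interval => // x _; lia.
    have := nup_split s (n - 2)%N; rewrite -!/(nup _).
    have -> : nup (n - 2)%N = l.
      by rewrite -[RHS]sz; apply/eqP; rewrite -all_count; apply/allP=> x /jlarge /=; lia.
    lia.
  + have : (nup s <= s.+1 - (i + 2))%N.
      by apply: count_interval => // x /jlarge /=; lia.
    lia.
  + by rewrite nup_pos nup_l.
- by move=> s t _ tS si st; apply: nup_step; rewrite ?memj.
- move=> s t st; rewrite /nup (nup_split s t) // -addnA leq_add2l addnC.
  suff: (count (fun x => s < x <= t)%N j <= t.+1 - s.+1)%N by lia.
  by apply: count_interval => // x _; lia.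
- move=> k /andP[k0 kl]; have kkn : (k <= nup (n - 2)%N)%N.
    rewrite /nup (_ : count _ _ = l) // -[RHS]sz; apply/eqP; rewrite -all_count.
    by apply/allP=> x /jlarge /=; lia.
  have ex : exists s, (k <= nup s)%N by exists (n - 2)%N.
  (* [nup] grows by at most one per step, so the least [s] with [k <= nup s] satisfies [nup s = k]
     and is a member of [j]. *)
  case: (ex_minnP ex) => s ks smin.
  have s0 : (i < s)%N by rewrite ltnNge; apply/negP=> /kk0; lia.
  have ks1 : (nup s.-1 < k)%N.
    by rewrite ltnNge; apply/negP=> /smin; lia.
  have := nup_split s.-1 s (leq_pred s); rewrite -!/(nup _) => e.
  have : (count (fun x => s.-1 < x <= s)%N j <= s.+1 - s)%N.
    by apply: count_interval => // x _; lia.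
  have /hasP[x xj /= xs] : has (fun x => s.-1 < x <= s)%N j.
    by rewrite has_count; lia.
  have xE : x = s by lia.
  have sn : (s < n)%N by rewrite -xE; have := jlarge x xj; lia.
  move=> c1; exists (Ordinal sn); last by split=> //=; lia.
  by rewrite memS /= -xE xj orbT.
- move=> k ki; have kn : (k < n)%N by have := range k; rewrite ki => /(_ isT); lia.
  by exists (Ordinal kn); rewrite // memS /= ki.
- by move=> k; rewrite memS => /range; lia.
Qed.
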